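(* Let $h\in C_0^\infty(\mathbb{R}_+)'$ and suppose that $$\langle h,\bar f\star f\rangle\ge0$$ for all $f\in C_0^\infty(\mathbb{R}_+)$. Then there exists a positive measure $M$ on $\mathbb{R}$ such that $$h(t)=\int_{-\infty}^\infty e^{-t\lambda}\,dM(\lambda),$$ where the integral converges for all $t>0$.
   Context: $\mathbb{R}_+=(0,\infty)$. $C_0^\infty(\mathbb{R}_+)'$ is the space of distributions on $\mathbb{R}_+$, regarded as continuous antilinear functionals on $C_0^\infty(\mathbb{R}_+)$; $\langle h,F\rangle$ is linear in $h$ and antilinear in $F$, so that $\langle h,F\rangle=\int_0^\infty h(t)\overline{F(t)}\,dt$ when $h$ is a locally integrable function. The Laplace convolution is $(\bar f_1\star f_2)(t)=\int_0^t\overline{f_1(s)}\,f_2(t-s)\,ds$. The conclusion means that the distribution $h$ coincides with the function given by the integral. ''Positive'' means nonnegative. *)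

(* Defs.v *)
From mathcomp Require Import all_boot all_order all_algebra.
From mathcomp Require Import all_classical all_reals all_analysis.
From mathcomp Require Import complex.

Set Implicit Arguments.
Unset Strict Implicit.
Unset Printing Implicit Defensive.

Import Order.TTheory GRing.Theory Num.Theory.
Import numFieldNormedType.Exports.

Local Open Scope classical_set_scope.
Local Open Scope ring_scope.
Local Open Scope complex_scope.

(* R[i] carries no normed-module structure over R in the library, so
   derivatives and integrals of functions R -> R[i] are taken on real and
   imaginary parts. *)

Definition cderive (R : realType) (k : nat) (f : R -> R[i]) (t : R) : R[i] :=
  derive1n k (fun x => complex.Re (f x)) t +i*
  derive1n k (fun x => complex.Im (f x)) t.

Definition smooth (R : realType) (g : R -> R) : Prop :=
  forall (k : nat) (t : R), derivable (derive1n k g) t 1.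

Definition csmooth (R : realType) (f : R -> R[i]) : Prop :=
  smooth (fun x => complex.Re (f x)) /\ smooth (fun x => complex.Im (f x)).

Definition cintegral (R : realType) (d : measure_display)
    (T : measurableType d) (mu : {measure set T -> \bar R})
    (D : set T) (f : T -> R[i]) : R[i] :=
  Rintegral mu D (fun x => complex.Re (f x)) +i*
  Rintegral mu D (fun x => complex.Im (f x)).

Definition csupp (R : realType) (f : R -> R[i]) : set R :=
  closure [set t | f t != 0].

(* C_0^oo(R_+); a test function on R_+ is identified with its extension by 0
   to R. *)
Definition test_function (R : realType) (f : R -> R[i]) : Prop :=
  [/\ csmooth f, compact (csupp f) & csupp f `<=` `]0, +oo[%classic].

Definition test_norm (R : realType) (N : nat) (F : R -> R[i]) : R :=
  \sum_(k < N.+1)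
    sup (range (fun t : R => ComplexField.Normc.normc (cderive k F t))).

(* Continuous antilinear functionals on C_0^oo(R_+): continuity is the usual
   seminorm estimate on each space of test functions supported in a fixed
   compact K.  Only the values of h on test functions are meaningful. *)
Definition is_distribution (R : realType) (h : (R -> R[i]) -> R[i]) : Prop :=
  (forall (a : R[i]) (F G : R -> R[i]), test_function F -> test_function G ->
     h (fun t => a * F t + G t) = a^* * h F + h G) /\
  (forall K : set R, compact K -> K `<=` `]0, +oo[%classic ->
     exists (C : R) (N : nat), forall F : R -> R[i],
       test_function F -> csupp F `<=` K ->
       ComplexField.Normc.normc (h F) <= C * test_norm N F).

Definition distribution_is_function (R : realType)
    (h : (R -> R[i]) -> R[i]) (u : R -> R[i]) : Prop :=
  [/\ locally_integrable `]0, +oo[%classic (fun t => complex.Re (u t)),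
      locally_integrable `]0, +oo[%classic (fun t => complex.Im (u t)) &
      forall F : R -> R[i], test_function F ->
        h F = cintegral (@lebesgue_measure R) `]0, +oo[%classic
                (fun t => u t * (F t)^*)].

Definition laplace_conv (R : realType) (f1 f2 : R -> R[i]) (t : R) : R[i] :=
  cintegral (@lebesgue_measure R) `[0, t]%classic
    (fun s => f1 s * f2 (t - s)).

(* Main.v *)
Require Import Defs.
From HB Require Import structures.
From mathcomp Require Import all_boot all_order all_algebra.
From mathcomp Require Import all_classical all_reals all_analysis.
From mathcomp Require Import complex polyrcf measurable_realfun.
From mathcomp Require Import ring lra.

(** For real f the hypothesis says that H = Re h is nonnegative on the
    convolution squares f * f.  Write F^ for the Laplace transform of a real
    test function F.  The key point is that F^ >= 0 on the whole line implies
    H F >= 0.  After mollifying by phi = psi * psi, H (F * phi) is a limit of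
    Riemann sums sum_k d F(kd) H (phi(. - kd)), and p |-> sum_k p_k H (phi(. - kd))
    is a functional on polynomials that is nonnegative on q^2 and on X q^2, hence
    on every polynomial nonnegative on the half-line; the Riemann sums of F^,
    which are polynomials in exp(- d l), are nonnegative up to a small multiple
    of 1 + exp(- B l).

    So F^ |-> H F is well defined and positive.  By Hahn-Banach it extends to a
    positive linear functional on all functions dominated by some
    exp(- a l) + exp(- b l), including indicators of bounded intervals, whose
    values form a distribution function; its Stieltjes measure M satisfies
    H F = \int F^ dM, and Fubini's theorem concludes.  The same positivity,
    applied to Im h and to - Im h, shows that h is real on real test functions. *)

Set Implicit Arguments.
Unset Strict Implicit.
Unset Printing Implicit Defensive.

Import Order.TTheory GRing.Theory Num.Theory.
Import numFieldNormedType.Exports.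

Local Open Scope classical_set_scope.
Local Open Scope ring_scope.

(** * Functionals on polynomials nonnegative on the half-line *)

(** The obstacle is that a real [l] corresponds to x = exp(- d l) > 0, so nonnegativity of F^ only
    gives polynomials nonnegative on the half-line, and positivity on squares q^2 alone says nothing
    about X. The second condition comes from the half-line being stable under all translations to
    the right, including by half a step: shifts by (i + 1/2) d and (j + 1/2) d add up to (i + j + 1)
    d, which is the factor X. The discretisation error must be controlled for every real [l],
    although it grows exponentially as [l] tends to minus infinity. The weight 1 + exp(- B l)
    absorbs it because B is chosen as a multiple of the step, so that the error is again a
    polynomial in x, with two terms. Finally, a positive extension is a priori only finitely
    additive. Mass misplaced at single points is repaired by taking right limits of the distribution
    function. Mass escaping to infinity is excluded because F^ is smaller, by a factor 1 / (1 +
    |l|), than a fixed sum of two exponentials on which the extension is finite; there is room for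
    this factor because the support of F is a compact subset of the open half-line. *)

Lemma horner_ge0_dense (R : realType) (p : {poly R}) (r d : R) (s : bool) :
  0 < d -> (forall t, 0 < t < d -> 0 <= p.[r + (-1) ^+ s * t]) -> 0 <= p.[r].
Proof.
move=> d0 H; rewrite leNgt; apply/negP => pr.
have /(poly_cont r p) [e e0 He] : 0 < - p.[r] by rewrite oppr_gt0.
set t := Num.min e d / 2.
have t0 : 0 < t by rewrite divr_gt0// lt_min e0.
have tm : t < Num.min e d by rewrite ltr_pdivrMr// ltr_pMr ?lt_min ?e0// ltr1n.
have := H t; rewrite t0 (lt_le_trans tm) ?ge_min ?lexx ?orbT// => /(_ isT).
have := He (r + (-1) ^+ s * t).
rewrite [r + _]addrC addrK normrM normrX normrN1 expr1n mul1r gtr0_norm//.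
rewrite (lt_le_trans tm) ?ge_min ?lexx// => /(_ isT).
by rewrite ltr_norml => /andP[_]; rewrite ltrBlDr addNr => /lt_le_trans/[apply]; rewrite ltxx.
Qed.

(* Subtracting the minimum of [p] on the half-line creates either a root at 0
   or a double root [r > 0]; dividing it out turns [L] into [q |-> L ('X * q)]
   or [q |-> L (('X - r)^2 * q)], which satisfy the same hypotheses. *)
Lemma stieltjes_functional_ge0 (R : realType) (p : {poly R}) (L : {poly R} -> R) :
  (forall a p q, L (a *: p + q) = a * L p + L q) ->
  (forall q, 0 <= L (q ^+ 2)) -> (forall q, 0 <= L ('X * q ^+ 2)) ->
  (forall x, 0 <= x -> 0 <= p.[x]) -> 0 <= L p.
Proof.
have [n] := ubnP (size p); elim: n => // n IH in p L *.
rewrite ltnS => sp Llin L1 LX p0.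
have LC c : 0 <= c -> 0 <= L c%:P.
  move=> c0; have := Llin c 1 0; rewrite addr0 -mul_polyC mulr1 => ->.
  have -> : L 0 = 0.
    have := Llin 1 0 0; rewrite scale1r addr0 mul1r => /eqP.
    by rewrite -subr_eq subrr eq_sym => /eqP.
  by rewrite addr0 mulr_ge0//; have := L1 1; rewrite expr1n.
have [/size1_polyC pC|p1] := leqP (size p) 1%N.
  by rewrite pC; apply: LC; have := p0 0 (lexx _); rewrite pC hornerC coefC eqxx.
have lc0 : 0 < lead_coef p.
  rewrite lt_neqAle eq_sym lead_coef_eq0 -size_poly_eq0 -lt0n (ltn_trans _ p1)//=.
  rewrite leNgt; apply/negP; rewrite -oppr_gt0 -lead_coefN => lcN.
  have [x0 Hx0] := poly_pinfty_gt_lc lcN.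
  have xm : x0 <= Num.max 0 x0 by rewrite le_max lexx orbT.
  have x00 : 0 <= Num.max 0 x0 by rewrite le_max lexx.
  have := p0 _ x00; have := Hx0 _ xm; rewrite hornerN.
  by move: lcN => /lt_le_trans/[apply]; rewrite oppr_gt0 ltNge => /negP.
(* The positive leading coefficient makes [p] exceed [p.[0]] beyond some point, so a minimum over a
   compact interval starting at 0 is a minimum over the half-line. *)
have [r r0 rmin] : exists2 r, 0 <= r & forall x, 0 <= x -> p.[r] <= p.[x].
  pose p' := p - p.[0]%:P.
  have lp' : lead_coef p' = lead_coef p.
    by rewrite lead_coefDl// size_polyN (leq_ltn_trans (size_polyC_leq1 _)).
  have [x0 Hx0] : exists x0, forall x, x >= x0 -> p'.[x] >= lead_coef p'.
    by apply: poly_pinfty_gt_lc; rewrite lp'.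
  have x00 : 0 <= Num.max 0 x0 by rewrite le_max lexx.
  have cp : {within `[0, Num.max 0 x0], continuous (horner p)}.
    by apply: continuous_subspaceT; exact: continuous_horner.
  have [c /[!in_itv]/= /andP[c0 cM] Hc] := EVT_min x00 cp.
  exists c => // x x_ge0; have [xM|/ltW xM] := leP x (Num.max 0 x0).
    by apply: Hc; rewrite in_itv/= x_ge0.
  apply: (@le_trans _ _ p.[0]); first by apply: Hc; rewrite in_itv/= lexx.
  have := Hx0 x; rewrite (le_trans _ xM) ?le_max ?lexx ?orbT// => /(_ isT).
  rewrite lp' /p' !hornerE; move: lc0 => /ltW/le_trans/[apply].
  by rewrite subr_ge0.
set m := p.[r]; pose q := p - m%:P.
have Lp : L p = L q + L m%:P.
  by have := Llin 1 q m%:P; rewrite scale1r mul1r /q subrK.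
rewrite Lp addr_ge0//; last by apply: LC; exact: p0.
have q0 x : 0 <= x -> 0 <= q.[x] by move=> /rmin; rewrite /q !hornerE subr_ge0.
have qr : root q r by rewrite /root /q !hornerE subrr.
have szq : (size q = size p)%N.
  by rewrite /q size_polyDl// size_polyN (leq_ltn_trans (size_polyC_leq1 _)).
have /factor_theorem[q1 q1E] := qr.
have q1N0 : q1 != 0.
  by apply: contraTneq p1 => q10; rewrite -szq q1E q10 mul0r size_poly0.
have szq1 : (size q1).+1 = size q by rewrite q1E size_Mmonic ?monicXsubC// size_XsubC addn2.
have [r00|rN0] := eqVneq r 0.
  have q1E' : q = 'X * q1 by rewrite q1E r00 subr0 mulrC.
  rewrite q1E'; apply: (IH q1 (fun q => L ('X * q))).
  - by rewrite -ltnS szq1 szq ltnS.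
  - by move=> a u v; rewrite mulrDr -scalerAr Llin.
  - exact: LX.
  - by move=> u; rewrite (_ : _ * _ = ('X * u) ^+ 2) ?L1//; ring.
  - have q1p t : 0 < t -> 0 <= q1.[t].
      by move=> t0; have := q0 t (ltW t0); rewrite q1E' hornerM hornerX pmulr_rge0.
    move=> x; rewrite le_eqVlt => /predU1P[<-|/q1p//].
    apply: (@horner_ge0_dense _ _ _ 1 false) => // t /andP[t0 _].
    by rewrite add0r expr0 mul1r q1p.
have {}r0 : 0 < r by rewrite lt_neqAle eq_sym rN0.
have q1E' x : q.[x] = q1.[x] * (x - r) by rewrite q1E hornerM hornerXsubC.
(* At an interior minimum [q = q1 * (X - r)] is nonnegative on both sides of [r], which forces
   [q1 <= 0] on the left and [q1 >= 0] on the right; hence the root is double. *)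
have q1r : root q1 r.
  rewrite /root eq_le; apply/andP; split.
    rewrite -oppr_ge0 -hornerN; apply: (@horner_ge0_dense _ _ _ r true) => // t /andP[t0 tr].
    have := q0 (r - t); rewrite subr_ge0 (ltW tr) => /(_ isT); rewrite q1E'.
    rewrite expr1 mulN1r [r - t - r]addrAC subrr add0r mulrN hornerN -mulNr.
    by rewrite pmulr_lge0.
  apply: (@horner_ge0_dense _ _ _ 1 false) => // t /andP[t0 _].
  have := q0 (r + t) (addr_ge0 (ltW r0) (ltW t0)); rewrite q1E'.
  by rewrite expr0 mul1r [r + t - r]addrAC subrr add0r pmulr_lge0.
have /factor_theorem[q2 q2E] := q1r.
have q2E' : q = ('X - r%:P) ^+ 2 * q2 by rewrite q1E q2E; ring.
have q2N0 : q2 != 0 by apply: contraNneq q1N0 => q20; rewrite q2E q20 mul0r.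
have szq2 : (size q2).+1 = size q1.
  by rewrite q2E size_Mmonic ?monicXsubC// size_XsubC addn2.
rewrite q2E'; apply: (IH q2 (fun q => L (('X - r%:P) ^+ 2 * q))).
- by rewrite (leq_trans _ sp)// -szq -szq1 -szq2 ltnS ltnW.
- by move=> a u v; rewrite mulrDr -scalerAr Llin.
- by move=> u; rewrite (_ : _ * _ = (('X - r%:P) * u) ^+ 2) ?L1//; ring.
- by move=> u; rewrite (_ : _ * _ = 'X * (('X - r%:P) * u) ^+ 2) ?LX//; ring.
- have q2p t : 0 <= t -> t != r -> 0 <= q2.[t].
    move=> t0 tr; have := q0 t t0; rewrite q2E' hornerM horner_exp hornerXsubC.
    by rewrite pmulr_rge0// exprn_even_gt0//= subr_eq0.
  move=> x x0; have [->|/(q2p _ x0)//] := eqVneq x r.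
  apply: (@horner_ge0_dense _ _ _ 1 false) => // t /andP[t0 _].
  by rewrite expr0 mul1r q2p ?addr_ge0 ?(ltW r0) ?(ltW t0)// -subr_eq0 addrAC subrr add0r gt_eqF.
Qed.

(** * Smooth functions of compact support *)

Section calculus.
Variable R : realType.
Implicit Types (f g df : R -> R) (a b c d x y t K r : R) (k n : nat).

(** A quadratic remainder is a convenient certificate of differentiability: it survives integration
    against a bounded function, and it applies at a point where a definition by cases changes
    branch. *)
Lemma is_derive_quad f c d K r : 0 < r ->
  (forall x, `|x - c| < r -> `|f x - f c - d * (x - c)| <= K * (x - c) ^+ 2) ->
  is_derive c 1 f d.
Proof.
move=> r0 H.
have cv : (fun h => h^-1 *: ((f \o shift c) (h *: (1 : R)) - f c)) @ 0^' --> d.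
  apply/cvgrPdist_le => e e0; near=> h.
  have hN0 : h != 0 by near: h; exact: nbhs_dnbhs_neq.
  have hr : `|h| < r by near: h; apply: dnbhs0_lt.
  have he : `|h| <= e / (`|K| + 1).
    by near: h; apply: dnbhs0_le; rewrite divr_gt0// ltr_pwDr.
  have := H (h + c); rewrite addrK => /(_ hr) Hh.
  rewrite /= /shift/= [h *: 1]mulr1 distrC.
  rewrite (_ : _ - d = h^-1 * (f (h + c) - f c - d * h)); last first.
    by rewrite /GRing.scale/=; field.
  rewrite normrM normfV ler_pdivrMl ?normr_gt0// (le_trans Hh)//.
  rewrite -real_normK ?num_real// expr2 mulrA [leRHS]mulrC ler_wpM2r//.
  rewrite (le_trans (_ : _ <= (`|K| + 1) * `|h|))//.
    by rewrite ler_wpM2r// (le_trans (ler_norm _))// lerDl.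
  by rewrite mulrC -ler_pdivlMr// ltr_pwDr.
by split; [apply: cvgP cv | exact: cvg_lim cv].
Unshelve. all: by end_near. Qed.

Lemma is_derive_continuous f df :
  (forall x, is_derive x 1 f (df x)) -> continuous f.
Proof.
move=> H x; apply: differentiable_continuous.
by apply/derivable1_diffP; case: (H x).
Qed.

Lemma le_MVT f df K a b : a <= b ->
  (forall x, is_derive x 1 f (df x)) ->
  (forall x, a <= x <= b -> `|df x| <= K) -> `|f b - f a| <= K * (b - a).
Proof.
move=> ab H HK.
have [|c /[!in_itv]/= cab ->] := MVT_segment ab (fun x _ => H x).
  exact/continuous_subspaceT/is_derive_continuous.
by rewrite normrM (@ger0_norm _ (b - a)) ?subr_ge0// ler_wpM2r ?subr_ge0// HK.
Qed.

Lemma derive_lipschitz f df K :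
  (forall x, is_derive x 1 f (df x)) -> (forall x, `|df x| <= K) ->
  forall x y, `|f x - f y| <= K * `|x - y|.
Proof.
move=> H HK x y; wlog xy : x y / y <= x.
  by move=> W; have [/W//|/ltW/W] := leP y x; rewrite distrC [`|y - x|]distrC.
by rewrite (ger0_norm (_ : 0 <= x - y)) ?subr_ge0// (le_MVT xy H).
Qed.

Lemma derive_taylor1 f df ddf K :
  (forall x, is_derive x 1 f (df x)) -> (forall x, is_derive x 1 df (ddf x)) ->
  (forall x, `|ddf x| <= K) ->
  forall x c, `|f x - f c - df c * (x - c)| <= K * (x - c) ^+ 2.
Proof.
move=> H1 H2 HK x c.
have K0 : 0 <= K by exact: le_trans (HK 0).
suff [z zc ->] : exists2 z, `|z - c| <= `|x - c| & f x - f c = df z * (x - c).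
  rewrite -mulrBl normrM -(@real_normK _ (x - c)) ?num_real// expr2 mulrA.
  rewrite ler_wpM2r// (le_trans (derive_lipschitz H2 HK _ _))//.
  by rewrite ler_wpM2l.
have ctn (u v : R) : {within `[u, v], continuous f}.
  exact/continuous_subspaceT/is_derive_continuous.
have [xc|cx] := leP x c.
  have [z /[!in_itv]/= /andP[xz zc] E] := MVT_segment xc (fun x _ => H1 x) (ctn _ _).
  exists z; last by rewrite -[LHS]opprB E -mulrN opprB.
  by rewrite !ler0_norm ?subr_le0// lerN2 lerB.
have [z /[!in_itv]/= /andP[xz zc] E] := MVT_segment (ltW cx) (fun x _ => H1 x) (ctn _ _).
by exists z => //; rewrite !ger0_norm ?subr_ge0 ?(ltW cx)// lerB.
Qed.

Lemma smooth_is_derive f : smooth f ->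
  forall k x, is_derive x 1 (derive1n k f) (derive1n k.+1 f x).
Proof. by move=> sf k x; rewrite derive1nS derive1E; exact/derivableP/sf. Qed.

Lemma is_derive_derive1n (D : nat -> R -> R) :
  (forall k x, is_derive x 1 (D k) (D k.+1 x)) ->
  forall k, derive1n k (D 0%N) = D k.
Proof.
move=> H; elim=> // k IH; rewrite derive1nS IH.
by apply/funext => x; rewrite derive1E; case: (H k x).
Qed.

Lemma is_derive_smooth (D : nat -> R -> R) :
  (forall k x, is_derive x 1 (D k) (D k.+1 x)) -> smooth (D 0%N).
Proof.
by move=> H k x; rewrite (is_derive_derive1n H); case: (H k x).
Qed.

(** Gives smoothness without a formula for the k-th derivative: it is enough to find a class
    containing [f] and closed under differentiation. *)
Lemma smooth_class (A : (R -> R) -> Prop) :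
  (forall f, A f -> exists2 df, A df & forall x, is_derive x 1 f (df x)) ->
  forall f, A f -> smooth f.
Proof.
move=> HA f Af k.
suff [g Ag <-] : exists2 g, A g & g = derive1n k f.
  by have [dg _ H] := HA _ Ag => t; case: (H t).
elim: k => [|k [g Ag E]]; first by exists f.
have [dg Adg H] := HA _ Ag; exists dg => //.
by rewrite derive1nS -E; apply/funext => x; rewrite derive1E; case: (H x).
Qed.

Lemma smooth_continuous f k : smooth f -> continuous (derive1n k f).
Proof. by move=> sf; apply: is_derive_continuous; exact: smooth_is_derive. Qed.

Lemma smooth_lin a f g : smooth f -> smooth g ->
  smooth (fun x => a * f x + g x) /\ forall k,
  derive1n k (fun x => a * f x + g x) =
  (fun x => a * derive1n k f x + derive1n k g x).
Proof.
move=> sf sg.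
pose D k x := a * derive1n k f x + derive1n k g x.
have H k x : is_derive x 1 (D k) (D k.+1 x).
  have := smooth_is_derive sf k x; have := smooth_is_derive sg k x => Hg Hf.
  by apply: (@is_deriveD _ _ _ (fun x => a * derive1n k f x) _ _ _ (a * _)); exact: is_deriveZ.
by split; [exact: (is_derive_smooth H) | exact: (is_derive_derive1n H)].
Qed.

Lemma is_derive_affine f d a b x : is_derive (a * x + b) 1 f d ->
  is_derive x 1 (fun y => f (a * y + b)) (a * d).
Proof.
move=> H.
have Ha : is_derive x 1 (fun y => a * y + b) a.
  have := is_deriveD (is_deriveZ a (is_derive_id x (1 : R))) (is_derive_cst b x 1).
  by rewrite addr0 /GRing.scale/= mulr1.
rewrite [a * d]mulrC; move: (@is_derive1_comp R f (fun y => a * y + b) x d a H Ha); exact: id.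
Qed.

Lemma smooth_affine f a b : smooth f ->
  smooth (fun x => f (a * x + b)) /\ forall k,
  derive1n k (fun x => f (a * x + b)) =
  (fun x => a ^+ k * derive1n k f (a * x + b)).
Proof.
move=> sf; pose D k x := a ^+ k * derive1n k f (a * x + b).
have D0 : D 0%N = fun x => f (a * x + b).
  by apply/funext => x; rewrite /D expr0 mul1r.
have H k x : is_derive x 1 (D k) (D k.+1 x).
  rewrite /D exprSr -mulrA; apply: is_deriveZ.
  by apply: is_derive_affine; exact: smooth_is_derive.
by rewrite -D0; split; [exact: (is_derive_smooth H) | exact: (is_derive_derive1n H)].
Qed.

(** The derivative of a product is a sum of products, so products alone are not closed under
    differentiation. The algebra generated by the smooth functions is, and [smooth_class] then
    replaces the Leibniz formula. *)
Inductive smooth_algebra : (R -> R) -> Prop :=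
| smooth_alg_base f : smooth f -> smooth_algebra f
| smooth_alg_add f g : smooth_algebra f -> smooth_algebra g ->
    smooth_algebra (fun x => f x + g x)
| smooth_alg_mul f g : smooth_algebra f -> smooth_algebra g ->
    smooth_algebra (fun x => f x * g x).

Lemma smooth_mul f g : smooth f -> smooth g -> smooth (fun x => f x * g x).
Proof.
move=> sf sg; apply: (@smooth_class smooth_algebra); last first.
  by apply: smooth_alg_mul; exact: smooth_alg_base.
move=> {sf sg} u; elim=> {f g u} [f sf|f g Af [df Adf Hf] Ag [dg Adg Hg]|f g Af [df Adf Hf] Ag [dg Adg Hg]].
- exists (derive1n 1 f); last by move=> x; exact: (smooth_is_derive sf 0%N x).
  apply: smooth_alg_base; apply: (@is_derive_smooth (fun k => derive1n k.+1 f)) => k x.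
  exact: smooth_is_derive.
- exists (fun x => df x + dg x); first exact: smooth_alg_add.
  by move=> x; have := is_deriveD (Hf x) (Hg x).
- exists (fun x => f x * dg x + g x * df x).
    by apply: smooth_alg_add; exact: smooth_alg_mul.
  by move=> x; have := is_deriveM (Hf x) (Hg x).
Qed.

(** A bounding interval instead of the exact support: sums, translates and convolutions have evident
    ones. For [b < a] it forces [f] to vanish. *)
Definition supp_in a b f := forall x, ~~ (a <= x <= b) -> f x = 0.

Lemma supp_in_derive a b f df : supp_in a b f ->
  (forall x, is_derive x 1 f (df x)) -> supp_in a b df.
Proof.
move=> sf H x xab.
have Hx : {near x, (cst 0 : R -> R) =1 f}.
  have : x \in (~` `[a, b]%classic) by rewrite inE/= in_itv/=; exact/negP.
  rewrite inE => xO.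
  have : nbhs x (~` `[a, b]%classic).
    by apply: open_nbhs_nbhs; split=> //; apply: closed_openC; exact: itv_closed.
  apply: filterS => y; rewrite /= in_itv/= => /negP yab.
  by rewrite sf.
have H0 : is_derive x 1 f 0 by apply: near_eq_is_derive Hx _; exact: is_derive_cst.
by have := @derive_val _ _ _ _ _ _ _ H0; rewrite (@derive_val _ _ _ _ _ _ _ (H x)).
Qed.

Lemma supp_in_derive1n a b f k : smooth f -> supp_in a b f ->
  supp_in a b (derive1n k f).
Proof.
move=> sf s0; elim: k => // k IH; apply: supp_in_derive IH _.
exact: smooth_is_derive.
Qed.

Lemma supp_in_bounded a b f : continuous f -> supp_in a b f ->
  exists2 K, 0 <= K & forall x, `|f x| <= K.
Proof.
move=> cf s0; have [ab|ba] := leP a b; last first.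
  exists 0 => // x; rewrite s0 ?normr0//; apply/negP => /andP[ax xb].
  by move: (le_trans ax xb); rewrite leNgt ba.
have [|c _ Hc] := @EVT_max R (fun x => `|f x|) a b ab.
  by apply: continuous_subspaceT => x; apply: cvg_norm; exact: cf.
exists `|f c| => // x; have [xab|xab] := boolP (a <= x <= b).
  by apply: Hc; rewrite in_itv.
by rewrite s0// normr0.
Qed.

Lemma smooth_bounded a b f k : smooth f -> supp_in a b f ->
  exists2 K, 0 <= K & forall x, `|derive1n k f x| <= K.
Proof.
move=> sf s0; apply: (@supp_in_bounded a b); first exact: smooth_continuous.
exact: supp_in_derive1n.
Qed.

Lemma supp_in_sub a b a' b' f : a' <= a -> b <= b' -> supp_in a b f -> supp_in a' b' f.
Proof.
move=> aa bb sf x xab; apply: sf; apply: contra xab => /andP[ax xb].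
by rewrite (le_trans aa)// (le_trans xb).
Qed.

Lemma poly_le_expR (p : {poly R}) :
  exists2 K, 0 <= K & forall y, 0 <= y -> `|p.[y]| <= K * expR y.
Proof.
have Xn n y : 0 <= y -> y ^+ n <= n`!%:R * expR y.
  case: n => [|n] y0; first by rewrite expr0 fact0 mul1r -expR0 ler_expR.
  rewrite -ler_pdivrMl ?ltr0n ?fact_gt0// mulrC.
  by apply: le_trans (expR_ge1Dxn n y0); rewrite lerDr.
exists (\sum_(i < size p) `|p`_i| * i`!%:R) => [|y y0].
  by apply: sumr_ge0 => i _; rewrite mulr_ge0.
rewrite horner_coef mulr_suml (le_trans (ler_norm_sum _ _ _))// ler_sum// => i _.
by rewrite normrM -mulrA ler_wpM2l// ger0_norm ?exprn_ge0// Xn.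
Qed.

(** The classical smooth function exp(-1/x), with a polynomial in 1/x as a factor so that the family
    is closed under differentiation. *)
Definition flat (p : {poly R}) x := if 0 < x then p.[x^-1] * expR (- x^-1) else 0.

Lemma is_derive_flat p x : is_derive x 1 (flat p) (flat ('X^2 * (p - p^`())) x).
Proof.
have [x0|x0|<-] := ltgtP 0 x.
- pose g y := p.[y^-1] * expR (- y^-1).
  have -> : flat ('X^2 * (p - p^`())) x =
      p.[x^-1] *: (expR (- x^-1) * x ^- 2) + expR (- x^-1) *: (p^`().[x^-1] * - x ^- 2).
    by rewrite /flat x0 !hornerE /GRing.scale/=; field; rewrite lt0r_neq0.
  have Hx : {near x, g =1 flat p}.
    near=> y; rewrite /flat /g.
    have -> // : 0 < y by near: y; exact: lt_nbhsr.
  apply: near_eq_is_derive Hx _.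
  have dV : is_derive x 1 (fun y => y^-1) (- x ^- 2).
    have := @is_deriveV _ id x 1 1 (lt0r_neq0 x0) (is_derive_id x (1 : R)).
    by rewrite /GRing.scale/= mulr1.
  have d1 := @is_derive1_comp R (horner p) _ x _ _ (is_derive_poly p _) dV.
  have := @is_derive1_comp R expR _ x _ _ (is_derive_expR _) (is_deriveN dV).
  by rewrite opprK => d2; exact: (is_deriveM d1 d2).
- have Hx : {near x, cst 0 =1 flat p}.
    near=> y; rewrite /flat ltNge.
    have -> // : y <= 0 by apply: ltW; near: y; exact: lt_nbhsl.
  apply: near_eq_is_derive Hx _.
  by rewrite /flat ltNge (ltW x0)/=; exact: is_derive_cst.
(* At the origin, with y = 1/x, the bound |y^2 p(y)| <= K exp(y) reads |flat p x| <= K x^2, so the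
   derivative is 0. *)
- have [K K0 HK] := poly_le_expR ('X^2 * p).
  apply: (@is_derive_quad _ _ _ K 1) => // y _.
  rewrite {2 3}/flat ltxx mul0r !subr0 /flat.
  have [y0|y0] := ltP 0 y; last by rewrite normr0 mulr_ge0// sqr_ge0.
  have := HK y^-1; rewrite invr_ge0 (ltW y0) => /(_ isT).
  rewrite hornerM hornerXn normrM ger0_norm ?sqr_ge0// exprVn => H.
  rewrite normrM (ger0_norm (expR_ge0 _)) expRN ler_pdivrMr ?expR_gt0//.
  rewrite [K * _]mulrC -mulrA -ler_pdivrMl ?exprn_gt0//.
Unshelve. all: by end_near. Qed.

Lemma smooth_flat p : smooth (flat p).
Proof.
apply: (@smooth_class (fun f => exists p, f = flat p)); last by exists p.
move=> _ [q ->]; exists (flat ('X^2 * (q - q^`()))); first by exists ('X^2 * (q - q^`())).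
exact: is_derive_flat.
Qed.

Lemma bump_exists a b : exists f,
  [/\ smooth f, supp_in a b f, forall x, 0 <= f x & forall x, a < x < b -> 0 < f x].
Proof.
have s1 := (smooth_affine 1 (- a) (@smooth_flat 1)).1.
have s2 := (smooth_affine (-1) b (@smooth_flat 1)).1.
exists (fun x => flat 1 (1 * x + - a) * flat 1 (-1 * x + b)).
split; first exact: smooth_mul.
- move=> x; rewrite negb_and -!ltNge /flat mul1r mulN1r [- x + b]addrC !subr_gt0.
  by case/orP => /ltW; rewrite leNgt => /negbTE ->; rewrite ?mul0r ?mulr0.
- by move=> x; rewrite /flat mulr_ge0//; case: ifP => // _; rewrite hornerC mul1r expR_ge0.
- move=> x /andP[ax xb]; rewrite /flat mul1r mulN1r [- x + b]addrC !subr_gt0 ax xb.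
  by rewrite !hornerC !mul1r mulr_gt0 ?expR_gt0.
Qed.

End calculus.

(** * Integrals of continuous functions of compact support *)

Section integrals.
Variable R : realType.
Implicit Types (f g u : R -> R) (a b c d x y t K r : R) (k n : nat).
Notation mu := (@lebesgue_measure R).

Lemma continuous_integrable_itv f a b : continuous f -> mu.-integrable `[a, b] (EFin \o f).
Proof.
move=> cf; apply: continuous_compact_integrable; first exact: segment_compact.
exact: continuous_subspaceT.
Qed.

Lemma continuous_integrable_sub f a b (D : set (measurableTypeR R)) : measurable D ->
  D `<=` `[a, b]%classic -> continuous f -> mu.-integrable D (EFin \o f).
Proof.
move=> mD Dab cf; apply: (@integrableS _ _ _ mu `[a, b]%classic D) => //.
exact: continuous_integrable_itv.
Qed.

Lemma supp_in_patch f a b (D : set (measurableTypeR R)) : supp_in a b f -> `[a, b]%classic `<=` D ->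
  f \_ D = f.
Proof.
move=> sf Dab; apply/funext => x; rewrite patchE; case: ifPn => // xD.
rewrite sf//; apply: contra xD => xab; rewrite inE; apply: Dab.
by rewrite /= in_itv.
Qed.

Lemma supp_in_integral f a b (D : set (measurableTypeR R)) : supp_in a b f ->
  `[a, b]%classic `<=` D -> \int[mu]_(x in D) f x = \int[mu]_x f x.
Proof. by move=> sf Dab; rewrite Rintegral_mkcond (supp_in_patch sf). Qed.

Lemma supp_in_integrable f a b (D : set (measurableTypeR R)) : measurable D -> continuous f -> supp_in a b f ->
  mu.-integrable D (EFin \o f).
Proof.
move=> mD cf sf; apply: (@integrableS _ _ _ mu setT) => //.
rewrite -(supp_in_patch sf (@subset_refl _ _)).
rewrite -restrict_EFin -integrable_mkcond//.
exact: continuous_integrable_itv.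
Qed.

(** Stated for an arbitrary measure because it serves both Lebesgue measure and the Stieltjes
    measure constructed below. *)
Lemma le_norm_integral_cst (m : {measure set (measurableTypeR R) -> \bar R})
    f c (D : set (measurableTypeR R)) K : measurable D -> m D = c%:E ->
  m.-integrable D (EFin \o f) -> (forall x, D x -> `|f x| <= K) ->
  `|\int[m]_(x in D) f x| <= K * c.
Proof.
move=> mD muD intf HK; apply: (le_trans (le_normr_Rintegral mD intf)).
have -> : K * c = \int[m]_(x in D) K by rewrite Rintegral_cst//= muD.
apply: le_Rintegral => //.
- by have := integrable_norm intf.
- apply/integrableP; split; first exact: measurable_cst.
  by rewrite /= integral_cst//= muD lte_mul_pinfty// ltry.
Qed.

Lemma le_norm_integral f a b K : a <= b -> continuous f -> supp_in a b f ->
  (forall x, `|f x| <= K) -> `|\int[mu]_x f x| <= K * (b - a).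
Proof.
move=> ab cf sf HK; rewrite -(supp_in_integral sf (@subset_refl _ _)).
apply: (@le_norm_integral_cst mu) => //.
  by rewrite /= lebesgue_measure_itv/= lte_fin; case: ltgtP ab => // ->; rewrite subrr.
exact: continuous_integrable_itv.
Qed.

Lemma integral_lin f g a b c : continuous f -> continuous g ->
  supp_in a b f -> supp_in a b g ->
  \int[mu]_x (c * f x + g x) = c * \int[mu]_x f x + \int[mu]_x g x.
Proof.
move=> cf cg sf sg; rewrite RintegralD//=; last 2 first.
- have := supp_in_integrable measurableT cf sf.
  by move=> /(integrableZl measurableT c); apply: eq_integrable.
- exact: supp_in_integrable sg.
by rewrite RintegralZl//; exact: supp_in_integrable sf.
Qed.

Lemma le_integral_supp f g a b : continuous f -> continuous g ->
  supp_in a b f -> supp_in a b g -> (forall x, f x <= g x) ->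
  \int[mu]_x f x <= \int[mu]_x g x.
Proof.
move=> cf cg sf sg fg; apply: le_Rintegral => //.
- exact: supp_in_integrable sf.
- exact: supp_in_integrable sg.
Qed.

Lemma integral_pos f a b c : continuous f -> supp_in a b f ->
  (forall x, 0 <= f x) -> 0 < f c -> 0 < \int[mu]_x f x.
Proof.
move=> cf sf f0 fc.
have : \forall x \near c, f c / 2 < f x.
  apply: (cvgr_gt _ (cf c)); by rewrite ltr_pdivrMr// ltr_pMr// ltr1n.
move=> /nbhs_ballP[r /= r0 Hr].
have sub : `[c - r / 2, c + r / 2]%classic `<=` ball c r.
  move=> x; rewrite /= in_itv/= /ball/= distrC => /andP[x1 x2].
  by rewrite (@le_lt_trans _ _ (r / 2))// ?ler_distl ?x1// ltr_pdivrMr// ltr_pMr// ltr1n.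
apply: (@lt_le_trans _ _ (\int[mu]_(x in `[c - r / 2, c + r / 2]) (f c / 2))).
  rewrite Rintegral_cst//= lebesgue_measure_itv/= lte_fin ltrD2l gt0_cp ?divr_gt0//=.
  by rewrite mulr_gt0 ?divr_gt0// subr_gt0 ltrD2l gt0_cp ?divr_gt0.
apply: (@le_trans _ _ (\int[mu]_(x in `[c - r / 2, c + r / 2]) f x)).
  apply: le_Rintegral => //.
  - by apply: continuous_integrable_itv => x; exact: cvg_cst.
  - exact: continuous_integrable_itv.
  - by move=> x /sub/Hr/ltW.
rewrite Rintegral_mkcond; apply: le_Rintegral => //.
- rewrite -restrict_EFin -integrable_mkcond//; exact: continuous_integrable_itv.
- exact: supp_in_integrable sf.
- by move=> x _; rewrite patchE; case: ifP.
Qed.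

Lemma integral_reflect f a b t : continuous f -> supp_in a b f ->
  \int[mu]_x f (t - x) = \int[mu]_x f x.
Proof.
move=> cf sf; have [ab|ba] := leP a b; last first.
  have f0 x : f x = 0.
    by apply: sf; apply/negP => /andP[/le_trans H /H]; rewrite leNgt ba.
  by apply: eq_Rintegral => x _; rewrite !f0.
have sf' : supp_in (t - b) (t - a) (fun x => f (t - x)).
  move=> x H; apply: sf; apply: contra H => /andP[xa xb].
  by rewrite lerBlDl -lerBlDr xb lerBrDl -lerBrDr xa.
rewrite -(supp_in_integral sf (@subset_refl _ _)) -(supp_in_integral sf' (@subset_refl _ _)).
congr fine.
have dF x : is_derive x 1 (fun x => t - x) (-1 : R).
  have := is_deriveB (is_derive_cst t x 1) (is_derive_id x (1 : R)).
  by rewrite sub0r.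
have dFE : (fun x => t - x)^`()%classic = cst (-1).
  by apply/funext => x; rewrite derive1E; case: (dF x).
have -> : `[a, b]%classic = `[(fun x => t - x) (t - a), (fun x => t - x) (t - b)]%classic.
  by rewrite /= !opprB ![t + _]addrC !subrK.
rewrite (@integration_by_substitution_decreasing _ (fun x => t - x) f (t - b) (t - a)).
- apply: eq_integral => x _; rewrite dFE /=; congr EFin.
  by rewrite [RHS]mulrC/= opprK mul1r.
- by rewrite lerD2l lerN2.
- by move=> x y _ _ xy; rewrite ltrD2l ltrN2.
- by rewrite dFE => x _; exact: cvg_cst.
- by rewrite dFE; exact: is_cvg_cst.
- by rewrite dFE; exact: is_cvg_cst.
- have cF : continuous (fun x => t - x) by exact: is_derive_continuous dF.
  split.
  + by move=> x _; case: (dF x).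
  + by apply: cvg_at_right_filter; exact: cF.
  + by apply: cvg_at_left_filter; exact: cF.
- exact: continuous_subspaceT.
Qed.

(** On a cell of length d the function stays within K d of its value at the left endpoint, so a cell
    costs K d^2 and the n + 1 cells together cost K b d. *)
Lemma riemann_sum f b K n : 0 <= b -> continuous f -> supp_in 0 b f ->
  (forall x y, `|f x - f y| <= K * `|x - y|) ->
  `|\int[mu]_x f x - \sum_(k < n.+1) b / n.+1%:R * f (k%:R * (b / n.+1%:R))|
     <= K * b * (b / n.+1%:R).
Proof.
move=> b0 cf sf lip; set d := b / n.+1%:R.
have K0 : 0 <= K.
  by have := le_trans (normr_ge0 _) (lip 1 0); rewrite subr0 normr1 mulr1.
have d0 : 0 <= d by rewrite divr_ge0.
suff H m : `|\int[mu]_(x in `[0, m%:R * d]) f x -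
     \sum_(k < m) d * f (k%:R * d)| <= m%:R * (K * d * d).
  have := H n.+1; have nd : n.+1%:R * d = b by rewrite mulrC /d divfK ?pnatr_eq0.
  rewrite !nd (supp_in_integral sf (@subset_refl _ _)) => /le_trans; apply.
  by have -> : n.+1%:R * (K * d * d) = K * (n.+1%:R * d) * d; [ring|rewrite nd].
elim: m => [|m IH].
  by rewrite mul0r set_itv1 Rintegral_set1 big_ord0 subrr normr0 mul0r.
have -> : \int[mu]_(x in `[0, m.+1%:R * d]) f x =
  \int[mu]_(x in `[0, m%:R * d]) f x + \int[mu]_(x in `]m%:R * d, m.+1%:R * d]) f x.
  rewrite addrC; apply/eqP; rewrite -subr_eq; apply/eqP.
  apply: Rintegral_itvB; first exact: continuous_integrable_itv.
    by rewrite bnd_simp mulr_ge0.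
  by rewrite bnd_simp ler_wpM2r// ler_nat.
rewrite big_ord_recr/= opprD addrACA (le_trans (ler_normD _ _))//.
rewrite -[in leRHS]natr1 mulrDl mul1r lerD//.
have muD : mu `]m%:R * d, m.+1%:R * d]%classic = (d - 0)%:E.
  rewrite lebesgue_measure_itv/= lte_fin -natr1 mulrDl mul1r ltrDl.
  have [_|d0'] := ltP 0 d; first by rewrite -EFinB addrAC subrr add0r subr0.
  by rewrite subr0; congr EFin; apply/eqP; rewrite eq_le d0.
have mdd : m%:R * d <= m.+1%:R * d by rewrite ler_wpM2r// ler_nat.
have sub : `]m%:R * d, m.+1%:R * d]%classic `<=` `[m%:R * d, m.+1%:R * d]%classic.
  by apply: subset_itvr; rewrite bnd_simp.
have -> : d * f (m%:R * d) = \int[mu]_(x in `]m%:R * d, m.+1%:R * d]) (f (m%:R * d)).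
  by rewrite Rintegral_cst//= muD subr0 mulrC.
have i1 : mu.-integrable `]m%:R * d, m.+1%:R * d] (EFin \o f).
  exact: continuous_integrable_sub sub cf.
have i2 : mu.-integrable `]m%:R * d, m.+1%:R * d] (EFin \o cst (f (m%:R * d))).
  by apply: continuous_integrable_sub sub _ => // x; exact: cvg_cst.
rewrite -RintegralB//.
rewrite -[leRHS]/(K * d * d) -[X in _ <= K * d * X]subr0.
apply: (@le_norm_integral_cst mu) => //.
  have mI : measurable (`]m%:R * d, m.+1%:R * d]%classic : set (measurableTypeR R)) by [].
  by apply: eq_integrable (integrableB mI i1 i2).
move=> x /=; rewrite in_itv/= => /andP[mx xm].
rewrite (le_trans (lip _ _))// ler_wpM2l// ger0_norm ?subr_ge0 ?(ltW mx)//.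
by rewrite lerBlDl (le_trans xm)// -natr1 mulrDl mul1r.
Qed.

End integrals.

(** * Convolution *)

Section convolution.
Variable R : realType.
Implicit Types (f g dg ddg u F : R -> R) (a b c d x y t K r : R) (k n : nat).
Notation mu := (@lebesgue_measure R).

(** Integrated over the whole line, which makes translation and reflection free of limits. For test
    functions supported in the open half-line the integrand lives on [0, t], so this agrees with the
    Laplace convolution. *)
Definition conv f g t := \int[mu]_x (f x * g (t - x)).

Lemma continuous_lin c f g : continuous f -> continuous g ->
  continuous (fun x => c * f x + g x).
Proof.
move=> cf cg x; apply: (@continuousD _ _ _ (fun x => c * f x) g); last exact: cg.
by apply: continuousM; [exact: cst_continuous|exact: cf].
Qed.

Lemma continuous_mul f g : continuous f -> continuous g ->
  continuous (fun x => f x * g x).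
Proof. by move=> cf cg x; apply: continuousM; [exact: cf|exact: cg]. Qed.

Lemma continuous_reflect g t : continuous g -> continuous (fun x => g (t - x)).
Proof.
move=> cg x; apply: (@continuous_comp _ _ _ (fun x => t - x) g); last exact: cg.
by apply: continuousB; [exact: cst_continuous|move=> ?; exact: cvg_id].
Qed.

Lemma continuous_mul_reflect f g t : continuous f -> continuous g ->
  continuous (fun x => f x * g (t - x)).
Proof. by move=> cf cg; apply: continuous_mul; last exact: continuous_reflect. Qed.

Lemma supp_in_mull a b f g : supp_in a b f -> supp_in a b (fun x => f x * g x).
Proof. by move=> sf x /sf ->; rewrite mul0r. Qed.

Lemma supp_in_reflect a b f t : supp_in a b f -> supp_in (t - b) (t - a) (fun x => f (t - x)).
Proof.
move=> sf x H; apply: sf; apply: contra H => /andP[xa xb].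
by rewrite lerBlDl -lerBlDr xb lerBrDl -lerBrDr xa.
Qed.

(** The second-order Taylor remainder of [g] is quadratic uniformly in the base point. Integrated
    against [f] it stays quadratic, so [is_derive_quad] differentiates under the integral sign. *)
Lemma is_derive_conv a b f g dg ddg K : a <= b -> continuous f -> supp_in a b f ->
  (forall x, is_derive x 1 g (dg x)) -> (forall x, is_derive x 1 dg (ddg x)) ->
  (forall x, `|ddg x| <= K) ->
  forall t, is_derive t 1 (conv f g) (conv f dg t).
Proof.
move=> ab cf sf H1 H2 HK t.
have cg : continuous g by exact: is_derive_continuous H1.
have cdg : continuous dg by exact: is_derive_continuous H2.
have [Kf Kf0 HKf] := supp_in_bounded cf sf.
apply: (@is_derive_quad _ _ _ _ (Kf * K * (b - a)) 1) => // x _.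
set u := fun s => f s * (g (x - s) - g (t - s) - (x - t) * dg (t - s)).
have uE : u = fun s => (-(x - t)) * (f s * dg (t - s)) + (-1 * (f s * g (t - s)) + f s * g (x - s)).
  by apply/funext => s; rewrite /u; ring.
have -> : conv f g x - conv f g t - conv f dg t * (x - t) = \int[mu]_s u s.
  rewrite uE !(@integral_lin _ _ _ a b)//.
  - by rewrite /conv; ring.
  - exact: continuous_mul_reflect.
  - exact: continuous_mul_reflect.
  - exact: supp_in_mull.
  - exact: supp_in_mull.
  - exact: continuous_mul_reflect.
  - by apply: continuous_lin; exact: continuous_mul_reflect.
  - exact: supp_in_mull.
  - by move=> s /sf ->; rewrite !mul0r mulr0 addr0.
rewrite mulrAC; apply: le_norm_integral => //.
- rewrite uE; apply: continuous_lin; first exact: continuous_mul_reflect.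
  by apply: continuous_lin; exact: continuous_mul_reflect.
- exact: supp_in_mull.
- move=> s; rewrite normrM -mulrA ler_pM//.
  have := derive_taylor1 H1 H2 HK (x - s) (t - s).
  have -> : x - s - (t - s) = x - t by ring.
  by rewrite [dg _ * _]mulrC.
Qed.

Lemma smooth_conv a b a' b' f g : a <= b -> continuous f -> supp_in a b f ->
  smooth g -> supp_in a' b' g ->
  smooth (conv f g) /\ forall k, derive1n k (conv f g) = conv f (derive1n k g).
Proof.
move=> ab cf sf sg s0.
have H k t : is_derive t 1 (conv f (derive1n k g)) (conv f (derive1n k.+1 g) t).
  have [K _ HK] := smooth_bounded k.+2 sg s0.
  exact: (is_derive_conv ab cf sf (smooth_is_derive sg k) (smooth_is_derive sg k.+1) HK).
by split; [exact: (is_derive_smooth H)|exact: (is_derive_derive1n H)].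
Qed.

Lemma supp_in_conv a b a' b' f g : supp_in a b f -> supp_in a' b' g ->
  supp_in (a + a') (b + b') (conv f g).
Proof.
move=> sf sg t H; rewrite /conv.
suff -> : (fun x => f x * g (t - x)) = cst 0 by rewrite Rintegral_cst// mul0r.
apply/funext => x /=; have [/andP[x1 x2]|/sf ->] := boolP (a <= x <= b); last by rewrite mul0r.
rewrite sg ?mulr0//; apply: contra H => /andP[x3 x4].
by rewrite -[t](subrK x) [_ + x]addrC !lerD.
Qed.

Lemma conv_comm a b a' b' f g : continuous f -> supp_in a b f ->
  continuous g -> supp_in a' b' g -> conv f g = conv g f.
Proof.
move=> cf sf cg sg; apply/funext => t; rewrite /conv.
rewrite -(@integral_reflect _ (fun x => f x * g (t - x)) a b t).
- apply: eq_Rintegral => x _; have -> : t - (t - x) = x by ring.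
  by rewrite mulrC.
- exact: continuous_mul_reflect.
- exact: supp_in_mull.
Qed.

Lemma integral_shift f a b s : continuous f -> supp_in a b f ->
  \int[mu]_x (f (x - s))%R = \int[mu]_x f x.
Proof.
move=> cf sf; have cf' := @continuous_reflect _ 0 cf.
have sf' := @supp_in_reflect _ _ _ 0 sf.
rewrite -(@integral_reflect _ _ _ _ 0 cf sf) -(@integral_reflect _ _ _ _ s cf' sf').
by apply: eq_Rintegral => x _; rewrite sub0r opprB.
Qed.

Lemma conv_shift f g a b s t x : continuous f -> supp_in a b f -> continuous g ->
  conv (fun y => f (y - s)) (fun y => g (y - t)) x = conv f g (x - (s + t)).
Proof.
move=> cf sf cg; rewrite /conv.
rewrite -(@integral_shift (fun y => f y * g (x - (s + t) - y)) a b s).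
- by apply: eq_Rintegral => y _; congr (_ * g _); ring.
- exact: continuous_mul_reflect.
- exact: supp_in_mull.
Qed.

Lemma continuous_shift f s : continuous f -> continuous (fun y => f (y - s)).
Proof.
move=> cf y; apply: (@continuous_comp _ _ _ (fun y => y - s) f); last exact: cf.
by apply: continuousB; [move=> ?; exact: cvg_id|exact: cst_continuous].
Qed.

Lemma supp_in_shift a b f s : supp_in a b f -> supp_in (a + s) (b + s) (fun y => f (y - s)).
Proof.
move=> sf x H; apply: sf; apply: contra H => /andP[h1 h2].
by rewrite -lerBrDr h1 -lerBlDr h2.
Qed.

Lemma continuous_combination n (p : 'I_n -> R) (g : 'I_n -> R -> R) :
  (forall i, continuous (g i)) -> continuous (fun y => \sum_(i < n) p i * g i y).
Proof.
elim: n p g => [|n IH] p g cg.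
  rewrite (_ : (fun _ => _) = cst 0); first exact: cst_continuous.
  by apply/funext => y; rewrite big_ord0.
rewrite (_ : (fun _ => _) = fun y => p ord0 * g ord0 y +
    \sum_(i < n) p (lift ord0 i) * g (lift ord0 i) y); last first.
  by apply/funext => y; rewrite big_ord_recl.
by apply: continuous_lin => //; exact: (IH (fun i => p (lift ord0 i)) (fun i => g (lift ord0 i))).
Qed.

Lemma supp_in_combination a b n (p : 'I_n -> R) (g : 'I_n -> R -> R) :
  (forall i, supp_in a b (g i)) -> supp_in a b (fun y => \sum_(i < n) p i * g i y).
Proof. by move=> sg x /sg H; rewrite big1// => i _; rewrite H mulr0. Qed.

Lemma conv_combination_r n (p : 'I_n -> R) (g : 'I_n -> R -> R) f a b x :
  continuous f -> supp_in a b f -> (forall i, continuous (g i)) ->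
  conv f (fun y => \sum_(i < n) p i * g i y) x = \sum_(i < n) p i * conv f (g i) x.
Proof.
move=> cf sf cg; rewrite /conv.
elim: n p g cg => [|n IH] p g cg.
  under eq_Rintegral do rewrite big_ord0 mulr0.
  by rewrite big_ord0 Rintegral_cst// mul0r.
under eq_Rintegral do rewrite big_ord_recl mulrDr mulrCA.
rewrite (@integral_lin _ _ _ a b).
- by rewrite big_ord_recl (IH (fun i => p (lift ord0 i)) (fun i => g (lift ord0 i))) // => i; exact: cg.
- exact: continuous_mul_reflect.
- apply: (@continuous_mul_reflect f
    (fun y => \sum_(i < n) p (lift ord0 i) * g (lift ord0 i) y) x cf).
  exact: (@continuous_combination n (fun i => p (lift ord0 i)) (fun i => g (lift ord0 i))).
- exact: supp_in_mull.
- exact: (@supp_in_mull _ _ f _ sf).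
Qed.

(** Shifts add under convolution, just as exponents do under multiplication. Positivity on
    convolution squares thereby becomes positivity of a quadratic form whose entries depend only on
    [t i + t j]. *)
Lemma conv_combination n (p t : 'I_n -> R) f a b x : continuous f -> supp_in a b f ->
  conv (fun y => \sum_(i < n) p i * f (y - t i)) (fun y => \sum_(i < n) p i * f (y - t i)) x
  = \sum_(i < n) \sum_(j < n) p i * p j * conv f f (x - (t i + t j)).
Proof.
move=> cf sf.
(* A crude interval containing the supports of all the translates at once. *)
pose a' := a - \sum_i `|t i|; pose b' := b + \sum_i `|t i|.
have ht i : `|t i| <= \sum_i `|t i| by rewrite (bigD1 i)//= lerDl sumr_ge0.
have st i : supp_in a' b' (fun y => f (y - t i)).
  move=> y H; apply: sf; apply: contra H => /andP[h1 h2].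
  by move: (ht i); rewrite ler_norml => /andP[h3 h4]; rewrite /a' /b'; apply/andP; split; lra.
have ct i : continuous (fun y => f (y - t i)) by exact: continuous_shift.
have cs := @continuous_combination n p _ ct.
have ss := @supp_in_combination _ _ n p _ st.
rewrite (@conv_combination_r n p (fun i y => f (y - t i)) _ a' b' x cs ss ct); apply: eq_bigr => i _.
rewrite (conv_comm cs ss (ct i) (st i)).
rewrite (@conv_combination_r n p (fun i y => f (y - t i)) _ a' b' x (ct i) (st i) ct) mulr_sumr; apply: eq_bigr => j _.
by rewrite mulrA (@conv_shift _ _ a b).
Qed.

End convolution.

(** * Positivity on convolution squares *)

Section positivity.
Variable R : realType.
Implicit Types (f g F : R -> R) (a b c d x y t K r l : R) (k n : nat).
Notation mu := (@lebesgue_measure R).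

Definition rtest f := smooth f /\ exists a b, [/\ 0 < a, a <= b & supp_in a b f].

Definition laplace F l := \int[mu]_t (F t * expR (- (t * l))).

(** The real form of the hypothesis. Continuity is phrased with any common bound [e] on the
    derivatives up to order [N], which spares the suprema of [test_norm]. *)
Record psd_functional (H : (R -> R) -> R) : Prop := PsdFunctional {
  psd_lin : forall a f g, rtest f -> rtest g ->
    H (fun x => a * f x + g x) = a * H f + H g;
  psd_cont : forall a b, 0 < a -> exists C N, 0 <= C /\
    forall f e, smooth f -> supp_in a b f ->
      (forall k x, (k <= N)%N -> `|derive1n k f x| <= e) -> `|H f| <= C * e;
  psd_pos : forall f, rtest f -> 0 <= H (conv f f) }.

Lemma smooth0 : smooth (fun _ : R => 0 : R).
Proof. by apply: (@is_derive_smooth _ (fun _ _ => 0)) => k x; exact: is_derive_cst. Qed.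

Lemma rtest0 : rtest (fun _ => 0).
Proof. by split; [exact: smooth0|exists 1, 1; split]. Qed.

Lemma rtest_lin c f g : rtest f -> rtest g -> rtest (fun x => c * f x + g x).
Proof.
move=> [sf [a [b [a0 ab s0]]]] [sg [a' [b' [a'0 ab' s0']]]].
split; first exact: (smooth_lin c sf sg).1.
exists (Num.min a a'), (Num.max b b'); split; first by rewrite lt_min a0.
  by rewrite le_max ge_min ab.
move=> x H.
by rewrite (supp_in_sub _ _ s0 H) ?(supp_in_sub _ _ s0' H) ?mulr0 ?addr0// ?ge_min ?le_max ?lexx ?orbT.
Qed.

Lemma rtest_combination n (p : 'I_n -> R) (g : 'I_n -> R -> R) :
  (forall i, rtest (g i)) -> rtest (fun y => \sum_(i < n) p i * g i y).
Proof.
elim: n p g => [|n IH] p g tg.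
  by under eq_fun do rewrite big_ord0; exact: rtest0.
under eq_fun do rewrite big_ord_recl.
by apply: (@rtest_lin _ _ (fun y => \sum_(i < n) p (lift ord0 i) * g (lift ord0 i) y)) => //; exact: IH.
Qed.

Lemma rtest_shift s f : 0 <= s -> rtest f -> rtest (fun x => f (x - s)).
Proof.
move=> s0 [sf [a [b [a0 ab s0']]]]; split.
  have := (smooth_affine 1 (- s) sf).1.
  by under eq_fun do rewrite mul1r.
exists (a + s), (b + s); split; [exact: ltr_wpDr|exact: lerD|exact: supp_in_shift].
Qed.

Lemma rtest_continuous f : rtest f -> continuous f.
Proof. by move=> [sf _]; exact: (@smooth_continuous _ f 0 sf). Qed.

Lemma rtest_conv f g : rtest f -> rtest g -> rtest (conv f g).
Proof.
move=> tf [sg [a' [b' [a'0 ab' s0']]]]; have cf := rtest_continuous tf.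
case: tf => [sf [a [b [a0 ab s0]]]].
split; first exact: (smooth_conv ab cf s0 sg s0').1.
exists (a + a'), (b + b'); split; [exact: addr_gt0|exact: lerD|exact: supp_in_conv].
Qed.

Lemma derive1n_shift f s k : smooth f ->
  derive1n k (fun x => f (x - s)) = fun x => derive1n k f (x - s).
Proof.
move=> sf; have := (smooth_affine 1 (- s) sf).2 k.
under eq_fun do rewrite mul1r; move=> ->.
by apply/funext => x; rewrite expr1n !mul1r.
Qed.

Lemma smooth_combination n (p : 'I_n -> R) (g : 'I_n -> R -> R) :
  (forall i, smooth (g i)) -> smooth (fun y => \sum_(i < n) p i * g i y) /\
  forall k, derive1n k (fun y => \sum_(i < n) p i * g i y) =
            fun y => \sum_(i < n) p i * derive1n k (g i) y.
Proof.
elim: n p g => [|n IH] p g sg.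
  have E (u : 'I_0 -> R -> R) : (fun y => \sum_(i < 0) p i * u i y) = fun=> 0.
    by apply/funext => y; rewrite big_ord0.
  split=> [|k]; first by rewrite E; exact: smooth0.
  rewrite !E; apply: (@is_derive_derive1n _ (fun _ _ => 0)) => j x; exact: is_derive_cst.
have E (u : 'I_n.+1 -> R -> R) : (fun y => \sum_(i < n.+1) p i * u i y) =
    fun y => p ord0 * u ord0 y + \sum_(i < n) p (lift ord0 i) * u (lift ord0 i) y.
  by apply/funext => y; rewrite big_ord_recl.
have [IH1 IH2] := IH (fun i => p (lift ord0 i)) (fun i => g (lift ord0 i)) (fun i => sg _).
have [S1 S2] := smooth_lin (p ord0) (sg ord0) IH1.
by split=> [|k]; rewrite !E// S2 IH2.
Qed.

Lemma ge0_of_inv_nat K x : (forall n, - (K / n.+1%:R) <= x) -> 0 <= x.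
Proof.
move=> Hn; rewrite leNgt; apply/negP => x0.
have nx0 : 0 < - x by rewrite oppr_gt0.
have /archi_boundP : 0 <= `|K| / - x by rewrite divr_ge0// ltW.
set n := Num.bound _ => Kn; have := Hn n; apply/negP; rewrite -ltNge ltrNr.
rewrite ltr_pdivrMr// (le_lt_trans (ler_norm _))//.
rewrite ltr_pdivrMr// mulrC in Kn; rewrite (lt_le_trans Kn)// ler_pM2l//.
by rewrite ler_nat.
Qed.

Section functional.
Variables (H : (R -> R) -> R) (Hlin : forall a f g, rtest f -> rtest g ->
    H (fun x => a * f x + g x) = a * H f + H g).

Lemma lin_functional0 : H (fun _ => 0) = 0.
Proof.
have := Hlin 1 rtest0 rtest0.
under eq_fun do rewrite mulr0 addr0.
by rewrite mul1r => /eqP; rewrite -subr_eq subrr eq_sym => /eqP.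
Qed.

Lemma lin_functional_sum n (p : 'I_n -> R) (g : 'I_n -> R -> R) :
  (forall i, rtest (g i)) ->
  H (fun y => \sum_(i < n) p i * g i y) = \sum_(i < n) p i * H (g i).
Proof.
elim: n p g => [|n IH] p g tg.
  by under eq_fun do rewrite big_ord0; rewrite big_ord0 lin_functional0.
under eq_fun do rewrite big_ord_recl; rewrite big_ord_recl -IH// Hlin//.
exact: (@rtest_combination _ (fun i => p (lift ord0 i)) (fun i => g (lift ord0 i))).
Qed.

End functional.

(** * Moment sequences satisfying Stieltjes' two positivity conditions *)

Section moments.
Variable G : nat -> R.
Implicit Types p q : {poly R}.

Let L p := \sum_(k < size p) p`_k * G k.

Let LE p n : (size p <= n)%N -> L p = \sum_(k < n) p`_k * G k.
Proof.
move=> pn; rewrite /L -(subnKC pn) big_split_ord/= [X in _ = _ + X]big1 ?addr0// => i _.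
by rewrite nth_default ?mul0r// leq_addr.
Qed.

Let Llin a p q : L (a *: p + q) = a * L p + L q.
Proof.
have pn : (size p <= maxn (size p) (size q))%N by rewrite leq_maxl.
have qn : (size q <= maxn (size p) (size q))%N by rewrite leq_maxr.
rewrite (LE pn) (LE qn) (@LE _ (maxn (size p) (size q))).
  rewrite mulr_sumr -big_split/=; apply: eq_bigr => k _.
  by rewrite coefD coefZ mulrDl mulrA.
rewrite (leq_trans (size_polyD _ _))// geq_max qn (leq_trans (size_scale_leq _ _))//.
Qed.

Let LXn m : L 'X^m = G m.
Proof.
rewrite /L size_polyXn big_ord_recr/= coefXn eqxx mul1r big1 ?add0r// => i _.
by rewrite coefXn ltn_eqF ?mul0r.
Qed.

Let Lsum n (c : 'I_n -> R) (p : 'I_n -> {poly R}) :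
  L (\sum_(i < n) c i *: p i) = \sum_(i < n) c i * L (p i).
Proof.
have L0 : L 0 = 0.
  by have := Llin 1 0 0; rewrite scaler0 addr0 mul1r => /eqP; rewrite -subr_eq subrr eq_sym => /eqP.
elim: n c p => [|n IH] c p; first by rewrite !big_ord0.
by rewrite !big_ord_recl Llin IH.
Qed.

Let Lsq m n (c : 'I_n -> R) : L ('X^m * (\sum_(i < n) c i *: 'X^i) ^+ 2) =
  \sum_i \sum_j c i * c j * G (m + (i + j))%N.
Proof.
have -> : 'X^m * (\sum_(i < n) c i *: 'X^i) ^+ 2 =
    \sum_i c i *: \sum_j c j *: ('X^(m + (i + j)) : {poly R}).
  rewrite expr2 mulr_suml mulr_sumr; apply: eq_bigr => i _.
  rewrite mulr_sumr mulr_sumr scaler_sumr; apply: eq_bigr => j _.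
  by rewrite -scalerAl -!scalerAr !exprD.
rewrite Lsum; apply: eq_bigr => i _; rewrite Lsum mulr_sumr; apply: eq_bigr => j _.
by rewrite LXn mulrA.
Qed.

(** The two quadratic forms are the Hankel forms of [G] and of [G] shifted by one. They express that
    the functional sending X^k to [G k] is nonnegative on q^2 and on X q^2. *)
Lemma moment_ge0 n (c : 'I_n -> R) :
  (forall N (v : 'I_N -> R), 0 <= \sum_i \sum_j v i * v j * G (i + j)%N) ->
  (forall N (v : 'I_N -> R), 0 <= \sum_i \sum_j v i * v j * G (i + j).+1) ->
  (forall x, 0 <= x -> 0 <= \sum_(i < n) c i * x ^+ i) ->
  0 <= \sum_(i < n) c i * G i.
Proof.
move=> G0 G1 c0; have -> : \sum_(i < n) c i * G i = L (\sum_(i < n) c i *: 'X^i).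
  by rewrite Lsum; apply: eq_bigr => i _; rewrite LXn.
apply: stieltjes_functional_ge0 => //.
- by move=> q; rewrite -[q]coefK poly_def -[_ ^+ 2]mul1r (Lsq 0).
- by move=> q; rewrite -[q]coefK poly_def -['X]expr1 (Lsq 1).
- move=> x /c0; rewrite horner_sum.
  by under [in X in _ -> X]eq_bigr do rewrite hornerZ hornerXn.
Qed.

End moments.

Lemma smooth_bounded_upto f a b N : smooth f -> supp_in a b f ->
  exists2 K, 0 <= K & forall k x, (k <= N)%N -> `|derive1n k f x| <= K.
Proof.
move=> sf s0; elim: N => [|N [K K0 HK]].
  have [K K0 HK] := smooth_bounded 0 sf s0.
  by exists K => // k x; rewrite leqn0 => /eqP ->.
have [K' K'0 HK'] := smooth_bounded N.+1 sf s0.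
exists (Num.max K K'); first by rewrite le_max K0.
move=> k x; rewrite leq_eqVlt ltnS le_max => /predU1P[->|/HK ->//].
by rewrite HK' orbT.
Qed.

(** The factor [1 + |l|] is what differentiating exp(- t l) in t costs. For [l >= 0] it is absorbed
    by exp(s l) >= 1 + s l with s >= a, whence the inverse of [a]. For [l < 0] it is at most exp(-
    l), whence the exponent [b + 1]. *)
Lemma expR_le_weight a b l s : 0 < a -> a <= s <= b ->
  (1 + `|l|) * expR (- (s * l)) <= (2 + a^-1) * (1 + expR (- ((b + 1) * l))).
Proof.
move=> a0 /andP[as_ sb].
have [l0|l0] := leP 0 l.
  rewrite ger0_norm//; apply: (@le_trans _ _ (1 + a^-1)); last first.
    have : 0 < expR (- ((b + 1) * l)) by exact: expR_gt0.
    have : 0 < a^-1 by rewrite invr_gt0.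
    nra.
  rewrite expRN ler_pdivrMr ?expR_gt0//.
  apply: (@le_trans _ _ ((1 + a^-1) * (1 + s * l))).
    have -> : (1 + a^-1) * (1 + s * l) = 1 + a^-1 + s * l + (s / a) * l by ring.
    have : 1 <= s / a by rewrite ler_pdivlMr// mul1r.
    have : 0 < a^-1 by rewrite invr_gt0.
    nra.
  by rewrite ler_wpM2l ?expR_ge1Dx// addr_ge0 ?invr_ge0 ?(ltW a0).
rewrite ltr0_norm// -mulrN.
apply: (@le_trans _ _ (expR (- ((b + 1) * l)))).
  apply: (@le_trans _ _ (expR (- l) * expR (s * - l))).
    by rewrite ler_wpM2r ?expR_ge0// expR_ge1Dx.
  by rewrite -expRD ler_expR; nra.
have : 0 < expR (- ((b + 1) * l)) by exact: expR_gt0.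
have : 0 < a^-1 by rewrite invr_gt0.
nra.
Qed.

Lemma is_derive_expRM l x : is_derive x 1 (fun t => expR (- (t * l))) (- l * expR (- (x * l))).
Proof.
have := @is_derive_affine _ expR (expR (- l * x + 0)) (- l) 0 x (is_derive_expR _).
by under eq_fun do rewrite addr0 mulrC mulrN; rewrite addr0 [- l * x]mulrC mulrN.
Qed.

(** The dependence on [l] is the point: it is confined to a weight that becomes 1 + x^(n + 1) when x
    = exp(- d l) and (n + 1) d = b + 1, and such an error can be fed back into the polynomial
    argument. *)
Lemma laplace_integrand_lipschitz F a b : 0 < a -> smooth F -> supp_in a b F ->
  exists2 C, 0 <= C & forall l x y,
    `|F x * expR (- (x * l)) - F y * expR (- (y * l))|
      <= C * (1 + expR (- ((b + 1) * l))) * `|x - y|.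
Proof.
move=> a0 sF s0; have [K K0 HK] := smooth_bounded_upto 1 sF s0.
exists (K * (2 + a^-1)); first by rewrite mulr_ge0// addr_ge0// invr_ge0 ltW.
move=> l; pose df x := F x *: (- l * expR (- (x * l))) + expR (- (x * l)) *: derive1n 1 F x.
have H x : is_derive x 1 (fun x => F x * expR (- (x * l))) (df x).
  exact: (is_deriveM (smooth_is_derive sF 0 x) (is_derive_expRM l x)).
apply: (derive_lipschitz H) => x.
have [xab|xab] := boolP (a <= x <= b); last first.
  have sdF := supp_in_derive1n 1 sF s0.
  rewrite /df s0// sdF// /GRing.scale/= mul0r mulr0 add0r normr0.
  by rewrite !mulr_ge0// ?addr_ge0 ?invr_ge0 ?(ltW a0) ?expR_ge0.
rewrite -mulrA.
apply: (@le_trans _ _ (K * ((1 + `|l|) * expR (- (x * l))))); last first.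
  by rewrite ler_wpM2l// expR_le_weight.
have -> : df x = (- (F x * l) + derive1n 1 F x) * expR (- (x * l)).
  by rewrite /df /GRing.scale/=; ring.
rewrite normrM (ger0_norm (expR_ge0 _)) mulrA ler_wpM2r ?expR_ge0//.
rewrite (le_trans (ler_normD _ _))// normrN normrM mulrDr mulr1 addrC.
by rewrite lerD ?ler_wpM2r// (HK 1%N, HK 0%N).
Qed.

End positivity.

(** * From positivity on convolution squares to positivity on nonnegative Laplace transforms *)

Section laplace_positivity.
Variable R : realType.
Implicit Types (f g F : R -> R) (a b c d x y t K r l : R) (k n : nat).
Notation mu := (@lebesgue_measure R).
Variable H : (R -> R) -> R.
Hypothesis HH : psd_functional H.

(** This is positivity on the convolution square of a combination of translates of [phi]. The shifts
    are nonnegative so that the translates remain test functions on the half-line. *)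
Let psd_gram phi n (v : 'I_n -> R) (s : 'I_n -> R) : rtest phi -> (forall i, 0 <= s i) ->
  0 <= \sum_i \sum_j v i * v j * H (fun x => conv phi phi (x - (s i + s j))).
Proof.
move=> tphi s0.
have tt i j : rtest (fun x => conv phi phi (x - (s i + s j))).
  by apply: rtest_shift; [exact: addr_ge0|exact: rtest_conv].
have := psd_pos HH (@rtest_combination _ n v _ (fun i => rtest_shift (s0 i) tphi)).
have -> : conv (fun y => \sum_i v i * phi (y - s i)) (fun y => \sum_i v i * phi (y - s i)) =
   fun x => \sum_i 1 * \sum_j v i * v j * conv phi phi (x - (s i + s j)).
  have [_ [a [b [_ _ sphi]]]] := tphi.
  apply/funext => x; rewrite (conv_combination v s x (rtest_continuous tphi) sphi).
  by apply: eq_bigr => i _; rewrite mul1r.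
rewrite (lin_functional_sum (psd_lin HH)); last first.
  by move=> i; apply: (@rtest_combination _ n (fun j => v i * v j)).
under eq_bigr => i _.
  rewrite mul1r (lin_functional_sum (psd_lin HH) (fun j => v i * v j)); last exact: tt.
  over.
by [].
Qed.

(* The bound [e * (1 + x ^ n)] is an admissible error: its image under [H] is
   [e] times a constant, because the two monomials are translates of
   [phi * phi] by [0] and by the fixed amount [n * d]. *)
Let psd_exponential_sum phi n d (p : nat -> R) e : rtest phi -> 0 <= d ->
  (forall x, 0 <= x -> 0 <= \sum_(k < n) p k * x ^+ k + e * (1 + x ^+ n)) ->
  0 <= \sum_(k < n) p k * H (fun x => conv phi phi (x - k%:R * d)) +
       e * (H (conv phi phi) + H (fun x => conv phi phi (x - n%:R * d))).
Proof.
move=> tphi d0 pos; pose G k := H (fun x => conv phi phi (x - k%:R * d)).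
have -> : H (conv phi phi) = G 0%N.
  by rewrite /G; under [in RHS]eq_fun do rewrite mul0r subr0.
rewrite -/(G n) -[X in 0 <= X + _]/(\sum_(k < n) p k * G k).
(* The polynomial with its error term. Writing the latter with two separate indicators keeps [n = 0]
   correct, where both contribute to the constant coefficient. *)
pose c k := p k * (k < n)%N%:R + (e * (k == 0%N)%:R + e * (k == n)%:R).
have cE (u : nat -> R) : \sum_(k < n.+1) c k * u k = \sum_(k < n) p k * u k + e * (u 0%N + u n).
  rewrite /c; under eq_bigr do rewrite !mulrDl.
  rewrite !big_split/= big_ord_recr/= ltnn mulr0 mul0r addr0; congr (_ + _).
    by apply: eq_bigr => k _; rewrite ltn_ord mulr1.
  rewrite big_ord_recl/= mulr1 [X in _ + X + _]big1 ?addr0; last first.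
    by move=> i _; rewrite mulr0 mul0r.
  rewrite big_ord_recr/= eqxx mulr1 big1 ?add0r ?mulrDr// => i _.
  by rewrite ltn_eqF// mulr0 mul0r.
rewrite -cE; apply: (@moment_ge0 _ G n.+1 (fun k : 'I_n.+1 => c k)).
- move=> N v; have := @psd_gram phi N v (fun i => i%:R * d) tphi.
  move=> /(_ (fun i => mulr_ge0 (ler0n _ _) d0)).
  by under eq_bigr do under eq_bigr do rewrite -mulrDl -natrD.
(* Two half-integer shifts add up to [(i + j + 1) * d]: this is the condition on X q^2. *)
- move=> N v; have := @psd_gram phi N v (fun i => (i%:R + 2^-1) * d) tphi.
  have h0 (i : 'I_N) : 0 <= (i%:R + 2^-1) * d by rewrite mulr_ge0// addr_ge0// invr_ge0.
  move=> /(_ h0); congr (0 <= _); apply: eq_bigr => i _; apply: eq_bigr => j _.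
  congr (_ * H _); apply/funext => x; congr (conv _ _ (_ - _)).
  by rewrite -mulrDl -[in RHS]addn1 !natrD; congr (_ * _); field.
- by move=> x x0; rewrite (cE (fun k => x ^+ k)) expr0 pos.
Qed.

Let psd_conv_square F phi : rtest phi -> rtest F ->
  (forall l, 0 <= laplace F l) -> 0 <= H (conv F (conv phi phi)).
Proof.
move=> tphi tF FL; set Phi := conv phi phi.
have tPhi : rtest Phi by exact: rtest_conv.
have [sF [a [b [a0 ab s0]]]] := tF.
have [sPhi [a' [b' [a'0 ab' s0']]]] := tPhi.
have cF := rtest_continuous tF.
have cPhi k : continuous (derive1n k Phi) by exact: smooth_continuous.
(* The mesh divides [0, b + 1] rather than [0, b], so that the exponent in the Lipschitz weight is
   exactly [n + 1] steps. *)
pose B := b + 1.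
have B0 : 0 < B by rewrite /B; lra.
have s0B : supp_in 0 B F by apply: supp_in_sub s0; [exact: ltW|rewrite /B; lra].
have [C1 C10 HC1] := laplace_integrand_lipschitz a0 sF s0.
have [C [N [C0 HC]]] := @psd_cont _ _ HH a' (B + b') a'0.
have [K1 K10 HK1] := smooth_bounded_upto 1 sF s0.
have [K2 K20 HK2] := smooth_bounded_upto N.+1 sPhi s0'.
pose d n : R := B / n.+1%:R.
have d0 n : 0 < d n by rewrite divr_gt0.
have dn n : n.+1%:R * d n = B by rewrite mulrC divfK ?pnatr_eq0.
pose p n k := d n * F (k%:R * d n).
pose G n x := \sum_(k < n.+1) p n k * Phi (x - k%:R * d n).
have tsh n (k : 'I_n.+1) : rtest (fun x => Phi (x - k%:R * d n)).
  by apply: rtest_shift => //; rewrite mulr_ge0// ltW.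
have sumE n (u : R -> R) : \sum_(k < n.+1) p n k * u (k%:R * d n) =
    \sum_(k < n.+1) d n * (F (k%:R * d n) * u (k%:R * d n)).
  by apply: eq_bigr => k _; rewrite /p mulrA.
pose e n := C1 * B * d n.
(* For x = exp(- d l) the sum of the [p n k * x ^+ k] is a Riemann sum of the integral
   [laplace F l >= 0], hence at least [- e n * (1 + x ^+ n.+1)]. *)
have expo n : 0 <= H (G n) + e n * (H Phi + H (fun x => Phi (x - B))).
  rewrite (lin_functional_sum (psd_lin HH) (fun k : 'I_n.+1 => p n k))// -(dn n).
  apply: psd_exponential_sum => //; first exact: ltW.
  (* The point x = 0 is not an exponential. Only the constant coefficient remains there, and it
     vanishes because the support of [F] starts at [a > 0]. *)
  move=> x; rewrite le_eqVlt => /predU1P[<-|x0].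
    rewrite big_ord_recl/= big1 => [|i _]; last by rewrite expr0n/= mulr0.
    have F0 : F 0 = 0 by apply: s0; apply/negP => /andP[]; rewrite leNgt a0.
    rewrite /p mul0r F0 mulr0 mul0r !add0r expr0n/= addr0 mulr1 /e.
    by rewrite mulr_ge0 ?(ltW (d0 n))// mulr_ge0// ltW.
  pose l := - ln x / d n.
  have xk k : expR (- (k%:R * d n * l)) = x ^+ k.
    rewrite -mulrA [d n * l]mulrC /l divfK ?gt_eqF// mulrN opprK expRM_natl.
    by rewrite lnK.
  have cFe : continuous (fun t => F t * expR (- (t * l))).
    apply: continuous_mul => //.
    exact: (is_derive_continuous (is_derive_expRM l)).
  have := @riemann_sum _ _ _ _ n (ltW B0) cFe (supp_in_mull _ s0B) (HC1 l).
  rewrite -/(d n).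
  rewrite -/(laplace F l) -(sumE n (fun s => expR (- (s * l)))).
  rewrite ler_norml => /andP[_]; rewrite lerBlDr => /(le_trans (FL l)).
  under eq_bigr do rewrite xk.
  rewrite addrC; congr (0 <= _ + _).
  by rewrite -/B -(dn n) xk /e (dn n); ring.
(* The Riemann sums converge to the convolution together with their derivatives up to order [N]. The
   Lipschitz bound on the [N]-th derivative of [Phi] is why [K2] covers order [N.+1]. *)
have appr n : `|H (conv F Phi) - H (G n)| <= C * (2 * K1 * K2 * B * d n).
  have tG : rtest (G n) by exact: (@rtest_combination _ n.+1 (fun k : 'I_n.+1 => p n k) _ (tsh n)).
  have tC : rtest (conv F Phi) by exact: rtest_conv.
  have -> : H (conv F Phi) - H (G n) = H (fun x => -1 * G n x + conv F Phi x).
    by rewrite (psd_lin HH)// mulN1r addrC.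
  have [SC DC] := smooth_conv ab cF s0 sPhi s0'.
  have [SG DG] := @smooth_combination _ n.+1 (fun k : 'I_n.+1 => p n k)
    (fun (k : 'I_n.+1) x => Phi (x - k%:R * d n)) (fun i => (tsh n i).1).
  have [SD DD] := smooth_lin (-1) SG SC.
  apply: HC => //.
    move=> x xab; rewrite /G big1 ?mulr0 ?add0r => [|k _].
      apply: (supp_in_conv s0 s0'); apply: contra xab => /andP[h1 h2].
      by rewrite /B; apply/andP; split; lra.
    have [/andP[h1 h2]|/s0B Fk] := boolP (0 <= k%:R * d n <= B); last first.
      by rewrite /p Fk mulr0 mul0r.
    rewrite s0' ?mulr0//; apply: contra xab => /andP[h3 h4].
    by apply/andP; split; lra.
  move=> k x kN; rewrite DD DG DC mulN1r addrC.
  under eq_bigr do rewrite derive1n_shift//.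
  rewrite (sumE n (fun s => derive1n k Phi (x - s))).
  apply: riemann_sum => //; first exact: ltW.
  - exact: continuous_mul_reflect.
  - exact: supp_in_mull.
  - move=> y z.
    have -> : F y * derive1n k Phi (x - y) - F z * derive1n k Phi (x - z) =
      (F y - F z) * derive1n k Phi (x - y) +
      F z * (derive1n k Phi (x - y) - derive1n k Phi (x - z)) by ring.
    rewrite (le_trans (ler_normD _ _))// !normrM -[2]/(1 + 1) 3!mulrDl !mul1r lerD//.
      rewrite mulrAC ler_pM//; last by rewrite HK2// ltnW.
      by apply: (derive_lipschitz (smooth_is_derive sF 0)) => w; exact: HK1.
    rewrite -mulrA ler_pM//; first exact: (HK1 0%N).
    have -> : `|y - z| = `|(x - y) - (x - z)| by rewrite distrC; congr (`| _ |); ring.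
    by apply: (derive_lipschitz (smooth_is_derive sPhi k)) => w; exact: HK2.
apply: (@ge0_of_inv_nat _ ((C1 * B * (H Phi + H (fun x => Phi (x - B))) + C * (2 * K1 * K2 * B)) * B)) => n.
rewrite -[_ * B / _]mulrA -/(d n).
have := expo n; have := appr n; rewrite ler_norml => /andP[h1 _] h2.
set S := H Phi + _ in h2 *.
have -> : (C1 * B * S + C * (2 * K1 * K2 * B)) * d n =
  e n * S + C * (2 * K1 * K2 * B * d n) by rewrite /e; ring.
lra.
Qed.

Lemma psd_laplace_ge0 F : rtest F -> (forall l, 0 <= laplace F l) -> 0 <= H F.
Proof.
move=> tF FL; have [sF [a [b [a0 ab s0]]]] := tF.
have cF k : continuous (derive1n k F) by exact: smooth_continuous.
(* The mollifiers live in [r, 2 r] with r <= 1, so convolving with them moves supports only to the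
   right and by at most 2. One continuity estimate on [a, b + 2] serves every [r]. *)
have [C [N [C0 HC]]] := @psd_cont _ _ HH a (b + 2) a0.
have [K K0 HK] := smooth_bounded_upto N.+1 sF s0.
apply: (@ge0_of_inv_nat _ (2 * C * K)) => n.
pose r : R := n.+1%:R^-1.
have r0 : 0 < r by rewrite invr_gt0.
have r1 : r <= 1 by rewrite invf_le1// ler1n.
have [psi [spsi s1 psi0 psipos]] := bump_exists (r / 2) r.
have r2 : r / 2 < r by rewrite ltr_pdivrMr// ltr_pMr// ltr1n.
have r20 : 0 < r / 2 by rewrite divr_gt0.
have tpsi : rtest psi by split=> //; exists (r / 2), r; split=> //; exact: ltW.
pose Phi := conv psi psi.
have cpsi := rtest_continuous tpsi.
have tPhi : rtest Phi by exact: rtest_conv.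
have sPhi : supp_in r (r + r) Phi.
  by have := supp_in_conv s1 s1; rewrite -splitr.
have cPhi := rtest_continuous tPhi.
have Phi0 x : 0 <= Phi x by apply: Rintegral_ge0 => y _; rewrite mulr_ge0.
set c := \int[mu]_x Phi x.
have c0 : 0 < c.
  (* At 3 r / 2 the integrand of [Phi] is positive for y = 3 r / 4, the midpoint of [r / 2, r],
     since both factors are then [psi (3 / 4 * r)]. *)
  apply: (integral_pos cPhi sPhi Phi0 (c := 3 / 2 * r)).
  apply: (@integral_pos _ _ (r / 2) r (3 / 4 * r)).
  - exact: continuous_mul_reflect.
  - exact: supp_in_mull.
  - by move=> y; rewrite mulr_ge0.
  - by rewrite mulr_gt0// psipos//; apply/andP; split; lra.
have tC : rtest (conv F Phi) by exact: rtest_conv.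
have tPhis : smooth Phi := tPhi.1.
have [SC DC] := smooth_conv ab (cF 0%N) s0 tPhis sPhi.
have rr : r <= r + r by lra.
have [SC' DC'] := smooth_conv rr cPhi sPhi sF s0.
have comm : conv F Phi = conv Phi F by apply: conv_comm (cF 0%N) s0 cPhi sPhi.
(* The mollifier is not normalised: the error is itself proportional to its mass [c], which is
   divided out at the end. *)
have : `|H (fun x => - c * F x + conv F Phi x)| <= C * (2 * r * K * c).
  have [SD DD] := smooth_lin (- c) sF SC.
  apply: HC => //.
    move=> x xab; rewrite (supp_in_sub (lexx a) _ s0 xab) ?mulr0 ?add0r ?lerDl//.
    apply: (supp_in_sub _ _ (supp_in_conv s0 sPhi)) xab; first lra.
    by rewrite lerD2l; lra.
  move=> k x kN; rewrite DD comm DC'.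
  have -> : - c * derive1n k F x + conv Phi (derive1n k F) x =
      \int[mu]_s (- derive1n k F x * Phi s + Phi s * derive1n k F (x - s)).
    rewrite (@integral_lin _ _ _ r (r + r)) -/c ?/conv //; first by congr (_ + _); ring.
      exact: continuous_mul_reflect.
    exact: supp_in_mull.
  have cI : continuous (fun s => - derive1n k F x * Phi s + Phi s * derive1n k F (x - s)).
    by apply: continuous_lin => //; exact: continuous_mul_reflect.
  have sI : supp_in r (r + r) (fun s => - derive1n k F x * Phi s + Phi s * derive1n k F (x - s)).
    by move=> s /sPhi ->; rewrite mulr0 mul0r addr0.
  have cm m : continuous (fun s => m * Phi s).
    by move=> s; apply: continuousM; [exact: cst_continuous|exact: cPhi].
  have sm m : supp_in r (r + r) (fun s => m * Phi s) by move=> s /sPhi ->; rewrite mulr0.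
  have im m : \int[mu]_s (m * Phi s) = m * c.
    by rewrite RintegralZl//; exact: supp_in_integrable sPhi.
  have bnd s : `|- derive1n k F x * Phi s + Phi s * derive1n k F (x - s)| <= 2 * r * K * Phi s.
    have [/andP[h1 h2]|/sPhi ->] := boolP (r <= s <= r + r); last first.
      by rewrite !mulr0 mul0r addr0 normr0.
    have -> : - derive1n k F x * Phi s + Phi s * derive1n k F (x - s) =
      (derive1n k F (x - s) - derive1n k F x) * Phi s by ring.
    rewrite normrM (ger0_norm (Phi0 s)) ler_wpM2r//.
    have HK' w : `|derive1n k.+1 F w| <= K by exact: HK.
    apply: (le_trans (derive_lipschitz (smooth_is_derive sF k) HK' _ _)).
    rewrite mulrC ler_wpM2r// [x - s]addrC addrK normrN ger0_norm; lra.
  rewrite ler_norml -mulNr -!im; apply/andP; split; apply: (@le_integral_supp _ _ _ r (r + r)) => // s.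
    by rewrite mulNr; have := bnd s; rewrite ler_norml => /andP[].
  by have := bnd s; rewrite ler_norml => /andP[].
rewrite (psd_lin HH)// ler_norml => /andP[_].
have := psd_conv_square tpsi tF FL; rewrite -/Phi => h1 h2.
have h3 : - (C * (2 * r * K)) * c <= H F * c by lra.
by move: h3; rewrite ler_pM2r// => h3; rewrite -/r; lra.
Qed.

End laplace_positivity.

(** * Hahn-Banach theorem *)

Section hahn_banach.
Variables (R : realType) (E : lmodType R) (V : set E).
Hypothesis VD : forall u v, V u -> V v -> V (u + v).
Hypothesis VZ : forall c u, V u -> V (c *: u).
Implicit Types (p q l : E -> R) (u v : E) (c : R).

(** Homogeneity is only an inequality, the form in which an infimum inherits it. Using it for [c]
    and for its inverse recovers equality. *)
Definition sublinear_on q :=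
  (forall u v, V u -> V v -> q (u + v) <= q u + q v) /\
  (forall c u, 0 < c -> V u -> q (c *: u) <= c * q u).

Lemma sublinear_on_pos q c u : sublinear_on q -> 0 < c -> V u -> q (c *: u) = c * q u.
Proof.
move=> [_ qZ] c0 Vu; apply/eqP; rewrite eq_le qZ//=.
have := qZ c^-1 (c *: u); rewrite invr_gt0 => /(_ c0 (VZ _ Vu)).
by rewrite scalerA mulVf ?gt_eqF// scale1r ler_pdivlMl.
Qed.

Lemma sublinear_on_0 q u : sublinear_on q -> V u -> q 0 = 0.
Proof.
move=> sq Vu; have V0 : V 0 by rewrite -(scale0r u); exact: VZ.
by have := sublinear_on_pos sq (ltr0Sn R 1) V0; rewrite scaler0; lra.
Qed.

Lemma sublinear_on_N q u : sublinear_on q -> V u -> - q (- u) <= q u.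
Proof.
move=> sq Vu; rewrite lerNl -subr_ge0 opprK -(sublinear_on_0 sq Vu) -[in q 0](addNr u).
by apply: sq.1 => //; rewrite -scaleN1r; exact: VZ.
Qed.

Lemma premaximal_sublinear_linear q : sublinear_on q ->
  (forall r, sublinear_on r -> (forall u, V u -> r u <= q u) ->
     forall u, V u -> q u <= r u) ->
  forall c u v, V u -> V v -> q (c *: u + v) = c * q u + q v.
Proof.
move=> sq qmin.
have VN u : V u -> V (- u) by rewrite -scaleN1r; exact: VZ.
have qD u v : V u -> V v -> q (u + v) = q u + q v.
  move=> Vu Vv; apply/eqP; rewrite eq_le sq.1//=.
  (* The largest slack of [q] in the direction [u] is removed: [r] is sublinear and below [q], so
     minimality gives [q <= r]. The choice s = 1 then yields q v <= q (u + v) - q u, the missing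
     superadditivity. *)
  pose S x := [set q (x + s *: u) - s * q u | s in [set s | 0 <= s]].
  pose r x := inf (S x).
  have Slb x : V x -> lbound (S x) (- q (- x)).
    move=> Vx _ [s /= s0 <-]; rewrite lerBrDr addrC lerBlDr.
    have -> : s * q u = q (s *: u).
      move: s0; rewrite le_eqVlt => /predU1P[<-|s0]; last by rewrite sublinear_on_pos.
      by rewrite scale0r mul0r (sublinear_on_0 sq Vu).
    have {1}-> : s *: u = x + s *: u + - x by rewrite addrAC subrr add0r.
    by apply: sq.1; [apply: VD => //; exact: VZ|exact: VN].
  have Sinf x : V x -> has_inf (S x).
    move=> Vx; split; last by exists (- q (- x)); exact: Slb.
    by exists (q (x + 0 *: u) - 0 * q u), 0 => //=.
  have rle x s : V x -> 0 <= s -> r x <= q (x + s *: u) - s * q u.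
    by move=> Vx s0; apply: ge_inf; [exact: (Sinf x Vx).2|exists s].
  have sr : sublinear_on r.
    split=> [x y Vx Vy|c x c0 Vx].
      rewrite -lerBlDr; apply: lb_le_inf => [|_ [s /= s0 <-]]; first exact: (Sinf x Vx).1.
      rewrite lerBlDr -lerBlDl; apply: lb_le_inf => [|_ [t /= t0 <-]]; first exact: (Sinf y Vy).1.
      rewrite lerBlDl (le_trans (rle _ _ (VD Vx Vy) (addr_ge0 s0 t0)))//.
      have := sq.1 _ _ (VD Vx (VZ s Vu)) (VD Vy (VZ t Vu)).
      by rewrite addrACA -scalerDl mulrDl; lra.
    rewrite mulrC -ler_pdivrMr//; apply: lb_le_inf => [|_ [s /= s0 <-]]; first exact: (Sinf x Vx).1.
    rewrite ler_pdivrMr// (le_trans (rle _ _ (VZ c Vx) (mulr_ge0 (ltW c0) s0)))//.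
    rewrite -scalerA -scalerDr sublinear_on_pos//; last by apply: VD => //; exact: VZ.
    by rewrite le_eqVlt; apply/orP; left; apply/eqP; ring.
  have rq x : V x -> r x <= q x.
    by move=> Vx; have := rle x 0 Vx (lexx _); rewrite scale0r addr0 mul0r subr0.
  have := qmin r sr rq v Vv; have := rle v 1 Vv ler01.
  by rewrite scale1r mul1r addrC [u + v]addrC; lra.
have qN u : V u -> q (- u) = - q u.
  move=> Vu; apply/eqP; rewrite -addr_eq0 -qD ?addNr ?(sublinear_on_0 sq Vu)//.
  exact: VN.
move=> c u v Vu Vv; rewrite qD//; last exact: VZ.
congr (_ + _); have [c0|c0|<-] := ltgtP 0 c.
- exact: sublinear_on_pos.
- rewrite -[c]opprK scaleNr qN ?sublinear_on_pos ?oppr_gt0 ?mulNr//.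
  exact: VZ.
- by rewrite scale0r mul0r (sublinear_on_0 sq Vu).
Qed.

(* A minimal sublinear functional below [p] is linear, so Zorn's lemma only
   has to be applied to the sublinear functionals themselves and no partially
   defined linear functional is needed. *)
Theorem hahn_banach p : sublinear_on p ->
  exists2 l, (forall c u v, V u -> V v -> l (c *: u + v) = c * l u + l v) &
             (forall u, V u -> l u <= p u).
Proof.
move=> sp; pose T := {q | sublinear_on q /\ forall u, V u -> q u <= p u}.
have p0 : sublinear_on p /\ forall u, V u -> p u <= p u by [].
(* The order is reversed, so that a maximal element is a minimal functional. It is only a preorder,
   since values outside [V] are not compared. *)
pose Rl : rel T := fun m m' => `[< forall u, V u -> sval m' u <= sval m u >].
have [] := @ZL_preorder T (exist _ p p0) Rl.
- by move=> q; apply/asboolP.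
- by move=> r s t /asboolP rs /asboolP st; apply/asboolP => u Vu; rewrite (le_trans (st u Vu)) ?rs.
- move=> A Atot; have [[q0 Aq0]|A0] := pselect (exists m, A m); last first.
    by exists (exist _ p p0) => s As; exfalso; apply: A0; exists s.
  pose S u := [set sval m u | m in A].
  have Slb u : V u -> lbound (S u) (- p (- u)).
    move=> Vu _ [[q [sq qp]] _ <-] /=; apply: le_trans (sublinear_on_N sq Vu).
    by rewrite lerN2 qp// -scaleN1r; exact: VZ.
  have Sinf u : V u -> has_inf (S u).
    move=> Vu; split; first by exists (sval q0 u), q0.
    by exists (- p (- u)); exact: Slb.
  pose r u := inf (S u).
  have rle u m : V u -> A m -> r u <= sval m u.
    by move=> Vu Am; apply: ge_inf; [exact: (Sinf u Vu).2|exists m].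
  have sr : sublinear_on r.
    split=> [u v Vu Vv|c u c0 Vu].
      rewrite -lerBlDr; apply: lb_le_inf => [|_ [q Aq <-]]; first exact: (Sinf u Vu).1.
      rewrite lerBlDr -lerBlDl; apply: lb_le_inf => [|_ [q' Aq' <-]]; first exact: (Sinf v Vv).1.
      rewrite lerBlDl.
      (* Subadditivity of the infimum needs one functional for both summands: the smaller of the two
         in the chain. *)
      have [/asboolP H|/asboolP H] := Atot _ _ Aq Aq'.
        rewrite (le_trans (rle _ _ (VD Vu Vv) Aq'))// (le_trans ((svalP q').1.1 _ _ Vu Vv))//.
        by rewrite lerD// H.
      rewrite (le_trans (rle _ _ (VD Vu Vv) Aq))// (le_trans ((svalP q).1.1 _ _ Vu Vv))//.
      by rewrite lerD// H.
    rewrite mulrC -ler_pdivrMr//; apply: lb_le_inf => [|_ [q Aq <-]]; first exact: (Sinf u Vu).1.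
    by rewrite ler_pdivrMr// (le_trans (rle _ _ (VZ c Vu) Aq))// mulrC; exact: (svalP q).1.2.
  have rp u : V u -> r u <= p u.
    by move=> Vu; rewrite (le_trans (rle _ _ Vu Aq0))// (svalP q0).2.
  exists (exist _ r (conj sr rp)) => q Aq; apply/asboolP => u Vu; exact: rle.
- move=> [q [sq qp]] qmax; exists q => //; apply: premaximal_sublinear_linear => //.
  move=> r sr rq; have rp u : V u -> r u <= p u by move=> Vu; rewrite (le_trans (rq u Vu)) ?qp.
  by have /qmax/asboolP : Rl (exist _ q (conj sq qp)) (exist _ r (conj sr rp)) by apply/asboolP.
Qed.

End hahn_banach.

(** * Positive functionals on exponentially dominated functions *)

Section representation.
Variable R : realType.
Implicit Types (u v w : R -> R) (a b c d x y z K C e : R) (n : nat).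

Definition exp_weight a b x := expR (- (a * x)) + expR (- (b * x)).

Definition exp_dominated u := exists a b C,
  [/\ 0 < a, 0 < b & forall x, `|u x| <= C * exp_weight a b x].

Definition loc_lipschitz u := forall r : R, exists K, forall x y,
  - r <= x <= r -> - r <= y <= r -> `|u x - u y| <= K * `|x - y|.

Lemma exp_weight_gt0 a b x : 0 < exp_weight a b x.
Proof. by rewrite addr_gt0// expR_gt0. Qed.

(** The sign of [x] decides which end of [a, b] gives the larger exponential; the sum of the two
    covers both cases. *)
Lemma le_exp_weight a b s x : a <= s <= b -> expR (- (s * x)) <= exp_weight a b x.
Proof.
move=> /andP[as_ sb]; have [x0|x0] := leP 0 x.
  by apply: ler_wpDr; rewrite ?expR_ge0// ler_expR lerN2 ler_wpM2r.
by apply: ler_wpDl; rewrite ?expR_ge0// ler_expR lerN2 ler_wnM2r// ltW.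
Qed.

Lemma exp_dominated_lin c u v : exp_dominated u -> exp_dominated v ->
  exp_dominated (fun x => c * u x + v x).
Proof.
move=> [a [b [C [a0 b0 HC]]]] [a' [b' [C' [a'0 b'0 HC']]]].
pose m := Num.min (Num.min a b) (Num.min a' b').
pose M := Num.max (Num.max a b) (Num.max a' b').
have C0 : 0 <= C by have := le_trans (normr_ge0 _) (HC 0); rewrite pmulr_lge0 ?exp_weight_gt0.
have C'0 : 0 <= C' by have := le_trans (normr_ge0 _) (HC' 0); rewrite pmulr_lge0 ?exp_weight_gt0.
exists m, M, (`|c| * C * 2 + C' * 2); split.
- by rewrite !lt_min a0 b0 a'0.
- by rewrite !lt_max a0.
move=> x; rewrite (le_trans (ler_normD _ _))// normrM mulrDl lerD// -!mulrA.
  rewrite ler_wpM2l// (le_trans (HC x))// ler_wpM2l// mulrDl mul1r lerD// le_exp_weight//.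
    by rewrite /m /M !ge_min !le_max !lexx.
  by rewrite /m /M !ge_min !le_max !lexx !orbT.
rewrite (le_trans (HC' x))// ler_wpM2l// mulrDl mul1r lerD// le_exp_weight//.
  by rewrite /m /M !ge_min !le_max !lexx !orbT.
by rewrite /m /M !ge_min !le_max !lexx !orbT.
Qed.

Lemma exp_dominated_le u v : (forall x, `|u x| <= `|v x|) -> exp_dominated v -> exp_dominated u.
Proof.
move=> uv [a [b [C [a0 b0 HC]]]]; exists a, b, C; split => // x.
exact: le_trans (uv x) (HC x).
Qed.

Lemma exp_dominated_weight a b : 0 < a -> 0 < b -> exp_dominated (exp_weight a b).
Proof.
move=> a0 b0; exists a, b, 1; split => // x.
by rewrite mul1r ger0_norm// ltW// exp_weight_gt0.
Qed.

Lemma exp_dominated_bounded u a b K : (forall x, `|u x| <= K) -> supp_in a b u ->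
  exp_dominated u.
Proof.
move=> uK su; have K0 := le_trans (normr_ge0 _) (uK 0).
exists 1, 1, (K * expR b); split => // x.
have [/andP[_ xb]|/su ->] := boolP (a <= x <= b); last first.
  by rewrite normr0 (mulr_ge0 (mulr_ge0 K0 (expR_ge0 _)) (ltW (exp_weight_gt0 _ _ _))).
rewrite (le_trans (uK x))// -mulrA ler_peMr// /exp_weight mulrDr mul1r.
rewrite -expRD; apply: ler_wpDr; first by rewrite expR_ge0.
by rewrite -expR0 ler_expR subr_ge0.
Qed.

Lemma loc_lipschitz_continuous u : loc_lipschitz u -> continuous u.
Proof.
move=> lu x; have [K HK] := lu (`|x| + 1).
apply/cvgrPdist_le => e e0; near=> y.
have xr : - (`|x| + 1) <= x <= `|x| + 1 by rewrite -ler_norml lerDl ler01.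
have xy : `|x - y| <= 1 by near: y; exact: cvgr_dist_le.
have yr : - (`|x| + 1) <= y <= `|x| + 1.
  rewrite -ler_norml (_ : y = x - (x - y)); last by ring.
  by rewrite (le_trans (ler_normB _ _))// lerD.
rewrite (le_trans (HK _ _ xr yr))// (@le_trans _ _ ((`|K| + 1) * `|x - y|))//.
  by rewrite ler_wpM2r// (le_trans (ler_norm _))// lerDl.
rewrite mulrC -ler_pdivlMr ?ltr_pwDr//; near: y; apply: cvgr_dist_le => //.
by rewrite divr_gt0// ltr_pwDr.
Unshelve. all: by end_near. Qed.

Lemma expR_lipschitz c x y r : - r <= x <= r -> - r <= y <= r ->
  `|expR (- (c * x)) - expR (- (c * y))| <= `|c| * expR (`|c| * r) * `|x - y|.
Proof.
move=> xr yr; wlog xy : x y xr yr / y <= x.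
  by move=> W; have [/W|/ltW/W] := leP y x; [exact|rewrite distrC [`|y - x|]distrC; exact].
rewrite (ger0_norm (_ : 0 <= x - y)) ?subr_ge0//.
apply: (@le_MVT _ (fun t => expR (- (c * t))) (fun t => - c * expR (- (t * c)))) => //.
  by move=> t; under eq_fun do rewrite mulrC; exact: is_derive_expRM.
move=> t /andP[yt tx]; rewrite normrM normrN ler_wpM2l// ger0_norm ?expR_ge0//.
rewrite ler_expR mulrC -mulNr (le_trans (ler_norm _))// normrM normrN ler_wpM2l//.
rewrite ler_norml; move: xr yr => /andP[h1 h2] /andP[h3 h4].
by apply/andP; split; lra.
Qed.

Lemma loc_lipschitz_weight a b : loc_lipschitz (exp_weight a b).
Proof.
move=> r; exists (`|a| * expR (`|a| * r) + `|b| * expR (`|b| * r)) => x y xr yr.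
rewrite /exp_weight opprD addrACA (le_trans (ler_normD _ _))// mulrDl.
by rewrite lerD// expR_lipschitz.
Qed.

(** Telescoping over steps of length [d]. It stands in for partitions: an additive bound has to be
    checked on short intervals only. *)
Lemma increment_chain (A Phi : R -> R) a b d : 0 < d -> a <= b ->
  (forall x y, a <= x -> x <= y -> y <= b -> y <= x + d ->
     `|A y - A x| <= Phi y - Phi x) ->
  `|A b - A a| <= Phi b - Phi a.
Proof.
move=> d0 ab H; have /archi_boundP : 0 <= (b - a) / d by rewrite divr_ge0 ?subr_ge0// ltW.
rewrite ltr_pdivrMr//; move: (Num.bound _) => n /ltW.
elim: n a ab H => [|n IH] a ab H nd.
  by apply: H => //; move: nd; rewrite mul0r; lra.
have [bad|bad] := leP b (a + d); first exact: H.
have := IH (a + d) (ltW bad).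
have h1 : `|A (a + d) - A a| <= Phi (a + d) - Phi a by apply: H; rewrite ?lerDl ?lexx ?(ltW d0) ?(ltW bad).
move=> /(_ _ _) h2.
have h3 : `|A b - A (a + d)| <= Phi b - Phi (a + d).
  apply: h2 => [x y ax|]; first by apply: H; lra.
  by move: nd; rewrite -natr1 mulrDl mul1r; lra.
rewrite (_ : A b - A a = (A b - A (a + d)) + (A (a + d) - A a)); last by ring.
by rewrite (le_trans (ler_normD _ _))//; lra.
Qed.

(** * The Stieltjes measure of a positive functional *)

Section stieltjes.
Variable l : (R -> R) -> R.
Hypothesis llin : forall c u v, exp_dominated u -> exp_dominated v ->
  l (fun x => c * u x + v x) = c * l u + l v.
Hypothesis lpos : forall u, exp_dominated u -> (forall x, 0 <= u x) -> 0 <= l u.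

Let lZ c u : exp_dominated u -> l (fun x => c * u x) = c * l u.
Proof.
move=> du; have d0 : exp_dominated (fun=> 0).
  by apply: (exp_dominated_le _ du) => x; rewrite normr0.
have l0 : l (fun=> 0) = 0.
  have := llin 1 d0 d0; under eq_fun do rewrite mulr0 addr0; lra.
by have := llin c du d0; rewrite l0 addr0 => <-; under [in RHS]eq_fun do rewrite addr0.
Qed.

Let lB u v : exp_dominated u -> exp_dominated v ->
  l (fun x => u x - v x) = l u - l v.
Proof.
move=> du dv; have := llin (-1) dv du; rewrite mulN1r [RHS]addrC => <-.
by congr l; apply/funext => x; rewrite mulN1r addrC.
Qed.

Let lle u v : exp_dominated u -> exp_dominated v -> (forall x, u x <= v x) -> l u <= l v.
Proof.
move=> du dv uv; rewrite -subr_ge0 -lB//; apply: lpos => [|x]; last by rewrite subr_ge0.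
have := exp_dominated_lin (-1) du dv.
by under eq_fun do rewrite mulN1r addrC.
Qed.

Let lnorm u v : exp_dominated v -> (forall x, `|u x| <= v x) -> `|l u| <= l v.
Proof.
move=> dv uv; have du : exp_dominated u.
  by apply: (exp_dominated_le _ dv) => x; rewrite (le_trans (uv x)) ?ler_norm.
rewrite ler_norml; apply/andP; split.
  rewrite -mulN1r -lZ//; apply: lle => //.
    by apply: (exp_dominated_le _ dv) => x; rewrite mulN1r normrN.
  by move=> x; have := uv x; rewrite mulN1r ler_norml => /andP[].
by apply: lle => // x; rewrite (le_trans (ler_norm _)).
Qed.

Let ind x y z : R := (x < z <= y)%R%:R.

Let dom_ind x y : exp_dominated (ind x y).
Proof.
apply: (@exp_dominated_bounded _ x y 1) => z; rewrite /ind.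
  by case: (x < z <= y); rewrite ?normr1 ?normr0.
by case: (boolP (x < z <= y)) => // /andP[/ltW -> ->].
Qed.

Let dom_mul_ind u x y : exp_dominated u -> exp_dominated (fun z => u z * ind x y z).
Proof.
apply: exp_dominated_le => z; rewrite normrM ler_piMr// /ind.
by case: (_ < _ <= _); rewrite ?normr1 ?normr0.
Qed.

(** The distribution function of [l], normalised to vanish at 0: the indicator of ]0, x] counts
    positively for x > 0 and that of ]x, 0] negatively for x < 0. *)
Let cum x := l (fun z => (z <= x)%R%:R - (z <= 0)%R%:R).

Let cumB x y : x <= y -> cum y - cum x = l (ind x y).
Proof.
move=> xy; have dc t : exp_dominated (fun z => (z <= t)%R%:R - (z <= 0)%R%:R).
  apply: (@exp_dominated_bounded _ (Num.min 0 t) (Num.max 0 t) 1) => z.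
    by case: (z <= t)%R; case: (z <= 0)%R; rewrite /= ?subrr ?subr0 ?sub0r ?normrN ?normr0 ?normr1.
  rewrite ge_min le_max; case: (leP z t) => zt; case: (leP z 0) => z0; rewrite ?subrr//=.
    by rewrite (ltW z0).
  by rewrite (ltW zt) orbT.
rewrite /cum -lB//; congr l; apply/funext => z; rewrite /ind.
case: (leP z y) => zy; case: (leP z x) => zx; rewrite ?andbT ?andbF/=; try ring.
lra.
Qed.

Let cum_nd : {homo cum : x y / x <= y}.
Proof. by move=> x y xy; rewrite -subr_ge0 cumB// lpos// => z; rewrite /ind ler0n. Qed.

Let S x := [set cum y | y in [set y | x < y]].

Let S_inf x : has_inf (S x).
Proof.
split; first by exists (cum (x + 1)), (x + 1) => //=; rewrite ltrDl.
by exists (cum x) => _ [y /= xy <-]; apply: cum_nd; exact: ltW.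
Qed.

(** Finite additivity of [l] does not make [cum] right-continuous, as a Stieltjes measure requires,
    so it is replaced by its right limit. *)
Let cumr x := inf (S x).

Let cumr_le x y : x < y -> cumr x <= cum y.
Proof. by move=> xy; apply: ge_inf; [exact: (S_inf x).2|exists y]. Qed.

Let le_cumr x : cum x <= cumr x.
Proof.
apply: lb_le_inf; first exact: (S_inf x).1.
by move=> _ [y /= xy <-]; apply: cum_nd; exact: ltW.
Qed.

Let cumr_nd : {homo cumr : x y / x <= y}.
Proof.
move=> x y; rewrite le_eqVlt => /predU1P[->//|xy].
exact: le_trans (cumr_le xy) (le_cumr y).
Qed.

Let cumr_rc : right_continuous cumr.
Proof.
move=> x; apply/cvgrPdist_le => e e0.
have [_ [y /= xy <-] ye] := inf_adherent e0 (S_inf x).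
near=> z; have xz : x < z by near: z; exact: nbhs_right_gt.
have zy : z < y by near: z; exact: nbhs_right_lt.
rewrite distrC ger0_norm ?subr_ge0 ?cumr_nd ?(ltW xz)//.
by rewrite lerBlDl (le_trans (cumr_le zy))// ltW.
Unshelve. all: by end_near. Qed.

Let cumulative_cumr : cumulative R R :=
  HB.pack cumr (isCumulative.Build R _ R cumr cumr_nd cumr_rc).

Let M : {measure set (measurableTypeR R) -> \bar R} :=
  lebesgue_stieltjes_measure cumulative_cumr.

Let M_itv x y : x <= y -> M `]x, y]%classic = (cumr y - cumr x)%:E.
Proof.
move=> xy; have := measurable_mu_extE (wlength cumulative_cumr) (is_ocitv x y).
by rewrite [X in _ = X -> _](wlength_itv_bnd cumulative_cumr false false xy).
Qed.

Let jump x := cumr x - cum x.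

Let jump_le x y : x < y -> jump x <= cum y - cum x.
Proof. by move=> xy; rewrite lerB// cumr_le. Qed.

Let jump_ge0 x : 0 <= jump x. Proof. by rewrite subr_ge0. Qed.

Let integrable_itv u x y : continuous u -> M.-integrable `]x, y] (EFin \o u).
Proof.
move=> cu; have [xy|yx] := leP x y; last by rewrite set_itv_ge ?bnd_simp -?leNgt ?(ltW yx)//; exact: integrable_set0.
apply: measurable_bounded_integrable => //.
- by rewrite /= M_itv// ltry.
- by apply: (@measurable_funS _ _ _ _ setT) => //; exact: continuous_measurable_fun.
have [|c _ Hc] := @EVT_max R (fun z => `|u z|) x y xy.
  by apply: continuous_subspaceT => z; apply: cvg_norm; exact: cu.
exists `|u c|; split; first exact: num_real.
move=> K uK z /= /[!in_itv]/= /andP[xz zy]; apply: le_trans (ltW uK).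
by apply: Hc; rewrite in_itv/= (ltW xz).
Qed.

(* [jump] measures how much mass of [l] is misplaced at a point by the passage
   to the right-continuous version; its contributions telescope away. *)
Let integral_itv u a b : loc_lipschitz u -> exp_dominated u -> a <= b ->
  \int[M]_(x in `]a, b]) u x = l (fun z => u z * ind a b z) + u b * jump b - u a * jump a.
Proof.
move=> lu du ab; have cu := loc_lipschitz_continuous lu.
(* The discrepancy up to [x], corrected by the jump there. The claim is that [A] is constant: on
   short intervals its increments are at most [e] times those of a monotone function, for every
   [e > 0]. *)
pose A x := \int[M]_(z in `]a, x]) u z - l (fun z => u z * ind a x z) - u x * jump x.
have l0 : l (fun=> 0) = 0.
  by have := lZ 0 du; under eq_fun do rewrite mul0r; rewrite mul0r.
have Aa : A a = - (u a * jump a).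
  rewrite /A set_itvoc0 Rintegral_set0 (_ : (fun _ => _) = fun=> 0) ?l0 ?subrr ?sub0r//.
  by apply/funext => z; rewrite /ind; case: ltP => //; rewrite ?mulr0// => az; rewrite leNgt az mulr0.
suff AE : A b = A a by move: AE; rewrite Aa /A; lra.
have [K HK] := lu (`|a| + `|b|).
have rng z : a <= z -> z <= b -> - (`|a| + `|b|) <= z <= `|a| + `|b|.
  move=> az zb; have := ler_norm b; have := ler_norm (- a); rewrite normrN.
  by have := normr_ge0 a; have := normr_ge0 b; move=> h1 h2 h3 h4; apply/andP; split; lra.
(* One [cumr] for the integral, one [cum] for [l], and one more [cum] for the jump at the left
   endpoint, which is at most the increment of [cum]. *)
pose Phi x := cumr x + 2 * cum x.
have Phi_ge0 : 0 <= Phi b - Phi a.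
  by have := cumr_nd ab; have := cum_nd ab; rewrite /Phi; lra.
suff small e : 0 < e -> `|A b - A a| <= e * (Phi b - Phi a).
  apply/eqP; rewrite -subr_eq0 -normr_le0; apply/ler_addgt0Pr => e e0; rewrite add0r.
  have P1 : 0 < Phi b - Phi a + 1 by rewrite ltr_wpDl.
  rewrite (le_trans (small (e / (Phi b - Phi a + 1)) _)) ?divr_gt0//.
  by rewrite mulrAC ler_pdivrMr// ler_wpM2l ?(ltW e0)// lerDl.
move=> e0; rewrite mulrBr.
apply: (@increment_chain A (fun x => e * Phi x) a b (e / (`|K| + 1))) => //.
  by rewrite divr_gt0// ltr_pwDr.
move=> x y ax xy yb yx.
have osc z z' : x <= z <= y -> x <= z' <= y -> `|u z - u z'| <= e.
  move=> /andP[h1 h2] /andP[h3 h4].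
  have zz : `|z - z'| <= e / (`|K| + 1) by rewrite ler_norml; apply/andP; split; lra.
  rewrite (le_trans (HK _ _ _ _)) ?rng ?(le_trans ax) ?(le_trans _ yb)//.
  rewrite (@le_trans _ _ ((`|K| + 1) * `|z - z'|))//.
    by rewrite ler_wpM2r// (le_trans (ler_norm _))// lerDl.
  by rewrite mulrC -ler_pdivlMr// ltr_pwDr.
have [<-|xNy] := eqVneq x y; first by rewrite !subrr normr0.
have xlty : x < y by rewrite lt_neqAle xNy.
(* On a constant, the integral and [l] differ exactly by the change of [jump]. Subtracting [u y]
   therefore leaves only terms governed by the oscillation of [u]. *)
have AB : A y - A x = \int[M]_(z in `]x, y]) (u z - u y)
    - l (fun z => (u z - u y) * ind x y z) + (u x - u y) * jump x.
  have E1 : \int[M]_(z in `]a, y]) u z - \int[M]_(z in `]a, x]) u z =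
      \int[M]_(z in `]x, y]) (u z - u y) + u y * (cumr y - cumr x).
    rewrite RintegralB//=; last 2 first.
    - exact: integrable_itv.
    - by apply: (@integrable_itv (fun=> u y)) => z; exact: cvg_cst.
    rewrite Rintegral_cst//= M_itv//= subrK.
    have -> : `]a, y]%classic = `]a, x]%classic `|` `]x, y]%classic.
      by rewrite -itv_bndbnd_setU// bnd_simp.
    rewrite Rintegral_setU//.
    - by rewrite addrAC subrr add0r.
    - by rewrite -itv_bndbnd_setU ?bnd_simp//; exact: integrable_itv.
    - by apply/disj_setPS => z [/=]; rewrite !in_itv/= => /andP[_ zx] /andP[]; rewrite ltNge zx.
  have E2 : l (fun z => u z * ind a y z) - l (fun z => u z * ind a x z) =
      l (fun z => (u z - u y) * ind x y z) + u y * (cum y - cum x).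
    rewrite -lB; [|exact: dom_mul_ind..].
    rewrite cumB// -lZ//.
    have d1 : exp_dominated (fun z => u y * ind x y z).
      have := exp_dominated_lin (u y - 1) (dom_ind x y) (dom_ind x y).
      by congr exp_dominated; apply/funext => z; ring.
    have d2 : exp_dominated (fun z => (u z - u y) * ind x y z).
      have := exp_dominated_lin (-1) d1 (dom_mul_ind x y du).
      by congr exp_dominated; apply/funext => z; ring.
    have := llin 1 d2 d1; rewrite mul1r => <-; congr l; apply/funext => z.
    rewrite /ind; case: (ltP a z) => az /=; case: (ltP x z) => xz /=;
      case: (leP z y) => zy /=; case: (leP z x) => zx /=; try ring; lra.
  by rewrite /A /jump; move: E1 E2; rewrite /jump; lra.
rewrite AB; apply: (@le_trans _ _ (e * (cumr y - cumr x) + e * (cum y - cum x) + e * (cum y - cum x))); last first.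
  by rewrite /Phi; lra.
rewrite (le_trans (ler_normD _ _))// lerD//; last first.
  rewrite normrM (ger0_norm (jump_ge0 x)) ler_pM ?jump_ge0 ?jump_le//.
  by apply: osc; rewrite ?lexx ?xy.
rewrite (le_trans (ler_normB _ _))// lerD//.
  apply: (@le_norm_integral_cst _ M) => //; first exact: M_itv.
    have ix := @integrable_itv u x y cu.
    have iy : M.-integrable `]x, y] (EFin \o cst (u y)).
      by apply: integrable_itv => z; exact: cvg_cst.
    have mI : measurable (`]x, y]%classic : set (measurableTypeR R)) by [].
    by apply: eq_integrable (integrableB mI ix iy).
  by move=> z /=; rewrite in_itv/= => /andP[xz zy]; apply: osc; rewrite ?(ltW xz) ?xy ?lexx.
rewrite cumB// -lZ//; apply: lnorm.
  have := exp_dominated_lin (e - 1) (dom_ind x y) (dom_ind x y).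
  by congr exp_dominated; apply/funext => z; ring.
move=> z; rewrite normrM /ind; case: (boolP (x < z <= y)) => /= [/andP[xz zy]|_].
  by rewrite normr1 !mulr1 osc// ?(ltW xz) ?xy ?lexx.
by rewrite normr0 !mulr0.
Qed.

(** The jump at [x] is at most the mass that [l] gives to ]x, x + 1], and over a unit interval the
    weight drops by a factor of at most exp(a + b). This controls the boundary terms uniformly. *)
Let weight_jump a b x : 0 < a -> 0 < b ->
  exp_weight a b x * jump x <= expR (a + b) * l (exp_weight a b).
Proof.
move=> a0 b0; have dw := exp_dominated_weight a0 b0.
have x1 : x < x + 1 by rewrite ltrDl.
apply: (@le_trans _ _ (exp_weight a b x * l (ind x (x + 1)))).
  by rewrite ler_wpM2l ?(ltW (exp_weight_gt0 _ _ _))// -cumB ?jump_le// ltW.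
have dE : exp_dominated (fun z => expR (a + b) * exp_weight a b z).
  have := exp_dominated_lin (expR (a + b) - 1) dw dw.
  by congr exp_dominated; apply/funext => z; ring.
rewrite -!lZ//; apply: le_trans (ler_norm _) (lnorm dE _) => z.
rewrite /ind; case: (boolP (x < z <= x + 1)) => [/andP[xz zx]|_]; last first.
  by rewrite mulr0 normr0 mulr_ge0 ?expR_ge0 ?(ltW (exp_weight_gt0 _ _ _)).
rewrite mulr1 ger0_norm ?(ltW (exp_weight_gt0 _ _ _))// /exp_weight mulrDr -!expRD.
by rewrite lerD// ler_expR; nra.
Qed.

Let integrable_weight a b : 0 < a -> 0 < b ->
  M.-integrable setT (EFin \o exp_weight a b).
Proof.
move=> a0 b0; have dw := exp_dominated_weight a0 b0.
have lw := @loc_lipschitz_weight a b; have cw := loc_lipschitz_continuous lw.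
have w0 x : 0 <= exp_weight a b x by exact/ltW/exp_weight_gt0.
have mw : measurable_fun setT (EFin \o exp_weight a b).
  by apply/measurable_EFinP; exact: continuous_measurable_fun.
pose D n : set (measurableTypeR R) := `]- n%:R, n%:R]%classic.
have DT : \bigcup_n D n = setT.
  apply/seteqP; split => // x _; exists (Num.bound `|x|) => //.
  have := archi_boundP (normr_ge0 x); rewrite ltr_norml => /andP[h1 h2].
  by rewrite /D /= in_itv/= h1 ltW.
pose B := l (exp_weight a b) + expR (a + b) * l (exp_weight a b).
have HB n : (\int[M]_(x in D n) (exp_weight a b x)%:E <= B%:E)%E.
  have iD : M.-integrable (D n) (EFin \o exp_weight a b) by exact: integrable_itv.
  have mD : measurable (D n) by exact: measurable_itv.
  rewrite -[leLHS]fineK; last exact: (integrable_fin_num mD iD).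
  rewrite lee_fin -[leLHS]/(\int[M]_(x in D n) exp_weight a b x)%R /D integral_itv//; last first.
    by have := ler0n R n; lra.
  (* The boundary term at [- n] enters with the favourable sign, so only the one at [n] has to be
     bounded. *)
  rewrite lerBlDr (le_trans _ (_ : B <= _))//; last first.
    by rewrite lerDl mulr_ge0.
  rewrite /B lerD// ?weight_jump//; apply: lle => //; first exact: dom_mul_ind.
  by move=> z; rewrite ler_piMr// /ind; case: (_ < _ <= _).
apply/integrableP; split => //.
under eq_integral => x _ do rewrite /= ger0_norm//.
apply: (@le_lt_trans _ _ B%:E); last exact: ltry.
rewrite -DT; apply: cvge_to_le (ge0_nondecreasing_set_cvg_integral _ _ _ _) _ => //.
- move=> m n mn; rewrite subsetEset; apply: subset_itv; rewrite bnd_simp ?ler_nat//.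
  by rewrite lerN2 ler_nat.
- by move=> n; exact: measurable_itv.
- by move=> n; exact: (@measurable_funS _ _ _ _ setT).
- by move=> n x _; rewrite lee_fin.
- exact: nearW.
Qed.

(** The extra factor [1 + |x|] does the work of a continuity property of [l]. Outside ]-n, n] it
    bounds [u] by a multiple of 1 / (n + 1) of a fixed weight, and positivity then makes the tail of
    [l u] small. *)
Let integral_weighted u a b C : 0 < a -> 0 < b -> loc_lipschitz u ->
  (forall x, `|u x| * (1 + `|x|) <= C * exp_weight a b x) ->
  \int[M]_x u x = l u.
Proof.
move=> a0 b0 lu Hu; have cu := loc_lipschitz_continuous lu.
set w := exp_weight a b; have dw : exp_dominated w := exp_dominated_weight a0 b0.
have w0 x : 0 <= w x by exact/ltW/exp_weight_gt0.
have C0 : 0 <= C.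
  by rewrite -(pmulr_lge0 _ (exp_weight_gt0 a b 0)) (le_trans _ (Hu 0)).
have uw x : `|u x| <= C * w x.
  by apply: le_trans (Hu x); rewrite ler_peMr// lerDl.
have uwn n x : n%:R <= `|x| -> `|u x| <= C / n.+1%:R * w x.
  move=> nx; rewrite mulrAC ler_pdivlMr//; apply: le_trans (Hu x).
  by rewrite ler_wpM2l// -natr1 addrC lerD2l.
have du : exp_dominated u by exists a, b, C; split.
have iw := integrable_weight a0 b0.
have iu : M.-integrable setT (EFin \o u).
  apply: (@le_integrable _ _ _ M setT _ _ (fun x => C%:E * (EFin \o w) x)%E) => //.
  - by apply/measurable_EFinP; exact: continuous_measurable_fun.
  - by move=> x _ /=; rewrite lee_fin [`|C * w x|]ger0_norm ?mulr_ge0.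
  - exact: integrableZl.
pose I := \int[M]_x w x.
have I0 : 0 <= I by apply: Rintegral_ge0 => x _; exact: w0.
have lw0 : 0 <= l w by apply: lpos.
pose J := expR (a + b) * l w.
apply/eqP; rewrite -subr_eq0 -normr_le0 -oppr_ge0.
(* Four errors: the tail of the integral gives [I], the tail of [l] gives [l w], and each of the two
   boundary terms at [n] and [- n] gives [J]. *)
apply: (@ge0_of_inv_nat _ (C * (I + l w + 2 * J))) => n.
rewrite lerN2; set D : set (measurableTypeR R) := `]- n%:R, n%:R]%classic.
have nn : - n%:R <= n%:R :> R by have := ler0n R n; lra.
have HD := integral_itv lu du nn.
have out z : ind (- n%:R) n%:R z = 0 -> n%:R <= `|z|.
  rewrite /ind; case: (boolP (- n%:R < z <= n%:R)) => [_ /eqP|]; first by rewrite oner_eq0.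
  rewrite negb_and -!real_leNgt ?num_real// -ltNge => /orP[zn|/ltW nz] _.
    by rewrite -normrN (le_trans _ (ler_norm _))// lerNr.
  by rewrite (le_trans nz)// ler_norm.
have indE z : (\1_D z : R) = ind (- n%:R) n%:R z.
  by rewrite indicE /ind /D mem_setE in_itv.
have bnd z : `|u z - u z * ind (- n%:R) n%:R z| <= C / n.+1%:R * w z.
  have [i1|i0] : ind (- n%:R) n%:R z = 1 \/ ind (- n%:R) n%:R z = 0.
    by rewrite /ind; case: (_ < _ <= _); [left|right].
    by rewrite i1 mulr1 subrr normr0 !mulr_ge0// invr_ge0.
  by rewrite i0 mulr0 subr0 uwn ?out.
have E1 : `|\int[M]_x u x - \int[M]_(x in D) u x| <= C / n.+1%:R * I.
  have iuD : M.-integrable setT (EFin \o (fun z => u z * ind (- n%:R) n%:R z)).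
    have := @integrable_itv u (- n%:R) n%:R cu.
    rewrite integrable_mkcond// restrict_EFin; congr (M.-integrable _ (_ \o _)).
    by apply/funext => z; rewrite -indE patchE indicE; case: ifP; rewrite ?mulr1 ?mulr0.
  have -> : \int[M]_(x in D) u x = \int[M]_z (u z * ind (- n%:R) n%:R z).
    rewrite Rintegral_mkcond; apply: eq_Rintegral => z _.
    by rewrite -indE patchE indicE; case: ifP; rewrite ?mulr1 ?mulr0.
  rewrite -RintegralB// (le_trans (le_normr_Rintegral _ _))//.
    by have := integrableB measurableT iu iuD; apply: eq_integrable.
  rewrite /I -RintegralZl//; apply: le_Rintegral => //.
  - have := integrable_norm (integrableB measurableT iu iuD).
    by apply: eq_integrable.
  - by have := integrableZl measurableT (C / n.+1%:R) iw; apply: eq_integrable.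
have E2 : `|l u - l (fun z => u z * ind (- n%:R) n%:R z)| <= C / n.+1%:R * l w.
  rewrite -lB//; last exact: dom_mul_ind.
  rewrite -lZ//; apply: lnorm => //.
  have := exp_dominated_lin (C / n.+1%:R - 1) dw dw.
  by congr exp_dominated; apply/funext => z; ring.
have E3 x : n%:R <= `|x| -> `|u x * jump x| <= C / n.+1%:R * J.
  move=> /uwn ux; rewrite normrM (ger0_norm (jump_ge0 _)).
  rewrite (le_trans (ler_wpM2r (jump_ge0 _) ux))// -[leLHS]mulrA.
  by apply: ler_wpM2l; [rewrite divr_ge0|exact: weight_jump].
have E4 : `|u n%:R * jump n%:R| <= C / n.+1%:R * J by apply: E3; rewrite ger0_norm.
have E5 : `|u (- n%:R) * jump (- n%:R)| <= C / n.+1%:R * J by apply: E3; rewrite normrN ger0_norm.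
have -> : \int[M]_x u x - l u = (\int[M]_x u x - \int[M]_(x in D) u x)
  - (l u - l (fun z => u z * ind (- n%:R) n%:R z)) + u n%:R * jump n%:R
  - u (- n%:R) * jump (- n%:R) by rewrite HD; ring.
have -> : C * (I + l w + 2 * J) / n.+1%:R = C / n.+1%:R * I + C / n.+1%:R * l w +
   C / n.+1%:R * J + C / n.+1%:R * J by ring.
rewrite (le_trans (ler_normB _ _))// lerD// (le_trans (ler_normD _ _))// lerD//.
by rewrite (le_trans (ler_normB _ _))// lerD.
Qed.

Theorem exp_dominated_representation :
  exists N : {sigma_finite_measure set (measurableTypeR R) -> \bar R},
    (forall a b, 0 < a -> 0 < b -> N.-integrable setT (EFin \o exp_weight a b)) /\
    (forall u a b C, 0 < a -> 0 < b -> loc_lipschitz u ->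
       (forall x, `|u x| * (1 + `|x|) <= C * exp_weight a b x) ->
       \int[N]_x u x = l u).
Proof.
exists (lebesgue_stieltjes_measure cumulative_cumr).
by split; [exact: integrable_weight|exact: integral_weighted].
Qed.

End stieltjes.
End representation.

(** * Laplace transforms *)

Section laplace_transform.
Variable R : realType.
Implicit Types (f g F G : R -> R) (a b c d t x y K : R).
Notation mu := (@lebesgue_measure R).

Lemma continuous_expRM x : continuous (fun t : R => expR (- (t * x))).
Proof. exact: (is_derive_continuous (is_derive_expRM x)). Qed.

Lemma continuous_laplace_integrand F x : continuous F ->
  continuous (fun t => F t * expR (- (t * x))).
Proof. by move=> cF; apply: continuous_mul => //; exact: continuous_expRM. Qed.

Lemma laplace_lin c f g x : rtest f -> rtest g ->
  laplace (fun t => c * f t + g t) x = c * laplace f x + laplace g x.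
Proof.
move=> tf tg; have cf := rtest_continuous tf; have cg := rtest_continuous tg.
case: tf => _ [a [b [_ _ sf]]]; case: tg => _ [a' [b' [_ _ sg]]].
rewrite /laplace.
under eq_Rintegral do rewrite mulrDl -mulrA.
apply: (@integral_lin _ _ _ (Num.min a a') (Num.max b b')).
- exact: continuous_laplace_integrand.
- exact: continuous_laplace_integrand.
- by apply: supp_in_mull; apply: supp_in_sub sf; rewrite ?ge_min ?le_max lexx.
- by apply: supp_in_mull; apply: supp_in_sub sg; rewrite ?ge_min ?le_max lexx orbT.
Qed.

(** Since the support starts at [a > 0], the factor exp(- (a / 2) x) can be set aside. The rest has
    exponents t - a / 2 >= a / 2 > 0, to which [expR_le_weight] applies and provides the factor
    [1 + |x|]. *)
Lemma laplace_decay F : rtest F -> exists a b C, [/\ 0 < a, 0 < b &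
  forall x, `|laplace F x| * (1 + `|x|) <= C * exp_weight a b x].
Proof.
move=> tF; have cF := rtest_continuous tF; case: tF => _ [a [b [a0 ab sF]]].
have [K K0 HK] := supp_in_bounded cF sF.
have a20 : 0 < a / 2 by rewrite divr_gt0.
have a2a : a / 2 < a by rewrite ltr_pdivrMr// ltr_pMr// ltr1n.
exists (a / 2), (b + 1), (K * (2 + (a / 2)^-1) * (b - a)); split=> //; first lra.
move=> x; have x1 : 0 < 1 + `|x| by rewrite ltr_pwDl.
rewrite -ler_pdivlMr//.
set W := exp_weight _ _ _.
have -> : K * (2 + (a / 2)^-1) * (b - a) * W / (1 + `|x|) =
  K * ((2 + (a / 2)^-1) * W / (1 + `|x|)) * (b - a) by ring.
apply: le_norm_integral => //.
- exact: continuous_laplace_integrand.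
- exact: supp_in_mull.
have W0 : 0 < W by exact: exp_weight_gt0.
have c0 : 0 < 2 + (a / 2)^-1 by rewrite addr_gt0// invr_gt0.
move=> t; rewrite normrM (ger0_norm (expR_ge0 _)).
have [/andP[at_ tb]|/sF ->] := boolP (a <= t <= b); last first.
  by rewrite normr0 mul0r mulr_ge0// divr_ge0 ?(ltW x1)// mulr_ge0// ltW.
rewrite ler_pM ?expR_ge0// ler_pdivlMr// mulrC.
have st : a / 2 <= t - a / 2 <= b - a / 2 by apply/andP; split; lra.
have -> : expR (- (t * x)) = expR (- ((t - a / 2) * x)) * expR (- (a / 2 * x)).
  by rewrite -expRD; congr expR; ring.
have -> : W = (1 + expR (- ((b - a / 2 + 1) * x))) * expR (- (a / 2 * x)).
  by rewrite mulrDl mul1r -expRD /W /exp_weight; congr (_ + expR _); ring.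
by rewrite !mulrA ler_wpM2r ?expR_ge0// expR_le_weight.
Qed.

Lemma laplace_dominated F : rtest F -> exp_dominated (laplace F).
Proof.
move=> /laplace_decay[a [b [C [a0 b0 H]]]]; exists a, b, C; split=> // x.
by apply: le_trans (H x); rewrite ler_peMr// lerDl.
Qed.

Lemma laplace_loc_lipschitz F : rtest F -> loc_lipschitz (laplace F).
Proof.
move=> tF r; have cF := rtest_continuous tF; case: tF => _ [a [b [a0 ab sF]]].
have [K K0 HK] := supp_in_bounded cF sF.
exists (K * (b * expR (b * r)) * (b - a)) => x y xr yr.
have r0 : 0 <= r by move: xr => /andP[]; lra.
have -> : laplace F x - laplace F y =
    \int[mu]_t (-1 * (F t * expR (- (t * y))) + F t * expR (- (t * x))).
  rewrite (@integral_lin _ _ _ a b) ?mulN1r 1?addrC//;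
    by [exact: continuous_laplace_integrand|exact: supp_in_mull].
rewrite mulrAC; apply: le_norm_integral => //.
- by apply: continuous_lin; exact: continuous_laplace_integrand.
- by move=> t /sF ->; rewrite !mul0r mulr0 addr0.
move=> t; rewrite mulN1r addrC -mulrBr normrM.
have [/andP[at_ tb]|/sF ->] := boolP (a <= t <= b); last first.
  by rewrite normr0 mul0r !mulr_ge0 ?expR_ge0//; lra.
rewrite -mulrA ler_pM// (le_trans (expR_lipschitz _ xr yr))// ler_wpM2r//.
have t0 : 0 <= t by lra.
by rewrite ger0_norm// ler_pM ?expR_ge0// ler_expR ler_wpM2r.
Qed.

Lemma laplace_bump_ge a b f : 0 < a -> a <= b -> rtest f -> supp_in a b f ->
  (forall t, 0 <= f t) -> forall x,
  (0 <= x -> expR (- (b * x)) * (\int[mu]_t f t) <= laplace f x) /\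
  (x <= 0 -> expR (- (a * x)) * (\int[mu]_t f t) <= laplace f x) /\
  0 <= laplace f x.
Proof.
move=> a0 ab tf sf f0 x; have cf := rtest_continuous tf.
have main c : (forall t, a <= t <= b -> expR (- (c * x)) <= expR (- (t * x))) ->
    expR (- (c * x)) * (\int[mu]_t f t) <= laplace f x.
  move=> Hc; rewrite -RintegralZl//; last exact: supp_in_integrable sf.
  apply: (@le_integral_supp _ _ _ a b).
  - by apply: continuous_mul => //; exact: cst_continuous.
  - exact: continuous_laplace_integrand.
  - by move=> t /sf ->; rewrite mulr0.
  - exact: supp_in_mull.
  - move=> t; have [/Hc h|/sf ->] := boolP (a <= t <= b); last by rewrite mulr0 mul0r.
    by rewrite mulrC ler_wpM2l.
split; [|split].
- by move=> x0; apply: main => t /andP[_ tb]; rewrite ler_expR lerN2 ler_wpM2r.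
- by move=> x0; apply: main => t /andP[at_ _]; rewrite ler_expR lerN2 ler_wnM2r.
- by apply: Rintegral_ge0 => t _; rewrite mulr_ge0 ?expR_ge0.
Qed.

Lemma rtest_bump a b : 0 < a -> a < b -> exists f,
  [/\ rtest f, supp_in a b f, forall t, 0 <= f t & 0 < \int[mu]_t f t].
Proof.
move=> a0 ab; have [f [sf suf f0 fp]] := bump_exists a b.
have tf : rtest f by split=> //; exists a, b; split=> //; exact: ltW.
exists f; split=> //; apply: (integral_pos (rtest_continuous tf) suf f0 (c := (a + b) / 2)).
by apply: fp; apply/andP; split; lra.
Qed.

(** A bump to the left of both exponents dominates for x >= 0 and one to the right of both for x <=
    0. The 2 in the normalisations accounts for the two exponentials of the weight. *)
Lemma weight_le_laplace a b : 0 < a -> 0 < b ->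
  exists2 G, rtest G & forall x, exp_weight a b x <= laplace G x.
Proof.
move=> a0 b0; pose m := Num.min a b; pose M := Num.max a b.
have m0 : 0 < m by rewrite lt_min a0.
have M0 : 0 < M by rewrite lt_max a0.
have m2 : m / 2 < m by rewrite ltr_pdivrMr// ltr_pMr// ltr1n.
have M1 : M < M + 1 by rewrite ltrDl.
have m20 : 0 < m / 2 by rewrite divr_gt0.
have [f [tf sf f0 If]] := rtest_bump m20 m2.
have [g [tg sg g0 Ig]] := rtest_bump M0 M1.
pose c := 2 / \int[mu]_t f t; pose d := 2 / \int[mu]_t g t.
have c0 : 0 <= c by rewrite divr_ge0// ltW.
have d0 : 0 <= d by rewrite divr_ge0// ltW.
have tdg : rtest (fun t => d * g t + 0) by apply: (rtest_lin d tg (rtest0 R)).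
exists (fun t => c * f t + (d * g t + 0)); first exact: rtest_lin.
move=> x; rewrite laplace_lin//.
have -> : laplace (fun t => d * g t + 0) x = d * laplace g x.
  rewrite (laplace_lin d x tg (rtest0 R)) [X in _ + X](_ : _ = 0) ?addr0//.
  by rewrite /laplace; under eq_Rintegral do rewrite mul0r; rewrite Rintegral_cst// mul0r.
have [f1 [_ f3]] := laplace_bump_ge m20 (ltW m2) tf sf f0 x.
have [_ [g2 g3]] := laplace_bump_ge M0 (ltW M1) tg sg g0 x.
have [x0|/ltW x0] := leP 0 x.
  apply: (@le_trans _ _ (c * laplace f x)); last by rewrite lerDl mulr_ge0.
  apply: (@le_trans _ _ (c * (expR (- (m * x)) * \int[mu]_t f t))).
    rewrite /c [expR _ * _]mulrC mulrA divfK ?gt_eqF// mulrDl mul1r.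
    by rewrite lerD// ler_expR lerN2 ler_wpM2r// /m ge_min lexx ?orbT.
  by rewrite ler_wpM2l// f1.
apply: (@le_trans _ _ (d * laplace g x)); last by rewrite lerDr mulr_ge0.
apply: (@le_trans _ _ (d * (expR (- (M * x)) * \int[mu]_t g t))).
  rewrite /d [expR _ * _]mulrC mulrA divfK ?gt_eqF// mulrDl mul1r.
  by rewrite lerD// ler_expR lerN2 ler_wnM2r// /M le_max lexx ?orbT.
by rewrite ler_wpM2l// g2.
Qed.

(** Laplace transforms of test functions are cofinal among the dominated functions. This is what
    makes the infimum in the Hahn-Banach step finite. *)
Lemma dominated_le_laplace u : exp_dominated u ->
  exists2 G, rtest G & forall x, `|u x| <= laplace G x.
Proof.
move=> [a [b [C [a0 b0 H]]]]; have [G tG HG] := weight_le_laplace a0 b0.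
have C0 : 0 <= C.
  by rewrite -(pmulr_lge0 _ (exp_weight_gt0 a b 0)) (le_trans _ (H 0)).
exists (fun t => C * G t + 0); first exact: (rtest_lin C tG (rtest0 R)).
move=> x; rewrite (laplace_lin C x tG (rtest0 R)) [X in _ + X](_ : _ = 0) ?addr0.
  by rewrite (le_trans (H x))// ler_wpM2l.
by rewrite /laplace; under eq_Rintegral do rewrite mul0r; rewrite Rintegral_cst// mul0r.
Qed.

End laplace_transform.

(** * Representation of the positive functional by a measure *)

Section psd_representation.
Variable R : realType.
Implicit Types (f g F G u v : R -> R) (a b c d t x y K : R).
Notation mu := (@lebesgue_measure R).

Lemma exp_dominated0 : exp_dominated (fun _ : R => 0 : R).
Proof. by exists 1, 1, 0; split=> // x; rewrite normr0 mul0r. Qed.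

(** The gauge [p u] is the infimum of [H F] over the transforms above [u]. A linear [l <= p] is
    positive because [p (- u) <= H 0 = 0] when [u >= 0], and it extends [H] because [p] at plus or
    minus [laplace F] is at most plus or minus [H F]. *)
Lemma psd_extension (H : (R -> R) -> R) : psd_functional H ->
  exists l : (R -> R) -> R, [/\
    forall c u v, exp_dominated u -> exp_dominated v ->
      l (fun x => c * u x + v x) = c * l u + l v,
    forall u, exp_dominated u -> (forall x, 0 <= u x) -> 0 <= l u &
    forall F, rtest F -> l (laplace F) = H F].
Proof.
move=> HH; have Hlin := psd_lin HH.
have HN F : rtest F -> H (fun t => -1 * F t + 0) = - H F.
  by move=> tF; rewrite Hlin ?(lin_functional0 Hlin) ?addr0 ?mulN1r//; exact: rtest0.
have laplace0 x : laplace (fun _ : R => 0) x = 0.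
  by rewrite /laplace; under eq_Rintegral do rewrite mul0r; rewrite Rintegral_cst// mul0r.
have lapZ c F x : rtest F -> laplace (fun t => c * F t + 0) x = c * laplace F x.
  by move=> tF; rewrite laplace_lin ?laplace0 ?addr0//; exact: rtest0.
have tZ c F : rtest F -> rtest (fun t => c * F t + 0).
  by move=> tF; apply: rtest_lin => //; exact: rtest0.
have HZ c F : rtest F -> H (fun t => c * F t + 0) = c * H F.
  by move=> tF; rewrite Hlin ?(lin_functional0 Hlin) ?addr0//; exact: rtest0.
(* Used in both directions, this also shows that [H F] depends on [laplace F] only. *)
have Hmono F G : rtest F -> rtest G -> (forall x, laplace F x <= laplace G x) -> H F <= H G.
  move=> tF tG FG; rewrite -subr_ge0 addrC -mulN1r -Hlin//.
  apply: psd_laplace_ge0 => //; first exact: rtest_lin.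
  by move=> x; rewrite laplace_lin// mulN1r addrC subr_ge0.
pose V : set (R -> R) := @exp_dominated R.
have VD u v : V u -> V v -> V (u + v).
  move=> Vu Vv; have := exp_dominated_lin 1 Vu Vv.
  by congr exp_dominated; apply/funext => x; rewrite mul1r.
have VZ c u : V u -> V (c *: u).
  move=> Vu; have := exp_dominated_lin c Vu exp_dominated0.
  by congr exp_dominated; apply/funext => x; rewrite addr0.
pose S u := [set H F | F in [set F | rtest F /\ forall x, u x <= laplace F x]].
pose p u := inf (S u).
have Sinf u : V u -> has_inf (S u).
  move=> /dominated_le_laplace[G tG HG]; split.
    by exists (H G), G => //; split=> // x; rewrite (le_trans (ler_norm _)).
  exists (- H G) => _ [F [tF HF] <-]; rewrite -HN//; apply: Hmono => //; first exact: tZ.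
  move=> x; rewrite lapZ// mulN1r; apply: le_trans (HF x).
  by rewrite lerNl (le_trans _ (HG x))// -normrN ler_norm.
have ple u F : V u -> rtest F -> (forall x, u x <= laplace F x) -> p u <= H F.
  by move=> Vu tF uF; apply: ge_inf; [exact: (Sinf u Vu).2|exists F].
have sp : sublinear_on V p.
  split=> [u v Vu Vv|c u c0 Vu].
    rewrite -lerBlDr; apply: lb_le_inf => [|_ [F [tF HF] <-]]; first exact: (Sinf u Vu).1.
    rewrite lerBlDr -lerBlDl; apply: lb_le_inf => [|_ [G [tG HG] <-]]; first exact: (Sinf v Vv).1.
    rewrite lerBlDl -[H F]mul1r -Hlin//; apply: ple; [exact: VD|exact: rtest_lin|].
    by move=> x; rewrite laplace_lin// mul1r lerD.
  rewrite mulrC -ler_pdivrMr//; apply: lb_le_inf => [|_ [F [tF HF] <-]]; first exact: (Sinf u Vu).1.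
  rewrite ler_pdivrMr// mulrC -HZ//; apply: ple; [exact: VZ|exact: tZ|].
  by move=> x; rewrite lapZ// ler_pM2l.
have [l llin lp] := hahn_banach VD VZ sp.
have l0 : l 0 = 0.
  have := llin 1 0 0 exp_dominated0 exp_dominated0.
  by rewrite scaler0 addr0 mul1r => /eqP; rewrite -subr_eq subrr eq_sym => /eqP.
have lN u : V u -> l (fun x => - u x) = - l u.
  move=> Vu; have := llin (-1) u 0 Vu exp_dominated0.
  rewrite l0 addr0 => E; rewrite -mulN1r -[RHS]addr0 -E; congr l; apply/funext => x.
  by rewrite -[RHS]/(-1 * u x) mulN1r.
have VN u : V u -> V (fun x => - u x) by apply: exp_dominated_le => x; rewrite normrN.
exists l; split.
- by move=> c u v Vu Vv; rewrite -llin.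
- move=> u Vu u0; rewrite -oppr_le0 -lN// (le_trans (lp _ (VN _ Vu)))//.
  rewrite -(lin_functional0 Hlin); apply: ple; [exact: VN|exact: rtest0|].
  by move=> x; rewrite laplace0 oppr_le0.
- move=> F tF; have VF := laplace_dominated tF.
  apply/eqP; rewrite eq_le (le_trans (lp _ VF)) ?ple//=.
  rewrite -lerN2 -lN// -HN// (le_trans (lp _ (VN _ VF)))// ple//; [exact: VN|exact: tZ|].
  by move=> x; rewrite lapZ// mulN1r.
Qed.

Theorem psd_representation (H : (R -> R) -> R) : psd_functional H ->
  exists N : {sigma_finite_measure set (measurableTypeR R) -> \bar R},
    (forall a b, 0 < a -> 0 < b -> N.-integrable setT (EFin \o exp_weight a b)) /\
    (forall F, rtest F -> \int[N]_x laplace F x = H F).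
Proof.
move=> /psd_extension[l [llin lpos lF]].
have [N [N1 N2]] := exp_dominated_representation llin lpos.
exists N; split=> // F tF; rewrite -lF//.
have [a [b [C [a0 b0 HC]]]] := laplace_decay tF.
exact: (N2 _ a b C a0 b0 (laplace_loc_lipschitz tF) HC).
Qed.

(** Both signs being positive, [H] vanishes wherever the transform is nonnegative. Every [F] is the
    difference of two such functions, [F + G] and [G], once [laplace G] dominates the absolute value
    of [laplace F]. *)
Lemma psd_opp_eq0 (H : (R -> R) -> R) : psd_functional H ->
  psd_functional (fun f => - H f) -> forall F, rtest F -> H F = 0.
Proof.
move=> HH HN.
have pos0 F : rtest F -> (forall x, 0 <= laplace F x) -> H F = 0.
  move=> tF F0; apply/eqP; rewrite eq_le (psd_laplace_ge0 HH tF F0) andbT.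
  by rewrite -oppr_ge0 (psd_laplace_ge0 HN tF F0).
move=> F tF; have [G tG HG] := dominated_le_laplace (laplace_dominated tF).
have G0 : H G = 0 by apply: pos0 => // x; exact: le_trans (HG x).
have : H (fun t => 1 * F t + G t) = 0.
  apply: pos0; first exact: rtest_lin.
  move=> x; rewrite laplace_lin// mul1r -lerBlDr sub0r lerNl.
  by rewrite (le_trans _ (HG x))// -normrN ler_norm.
by rewrite (psd_lin HH)// G0 addr0 mul1r.
Qed.

(** * Interchanging integration in t and in the spectral variable *)

Section fubini.
Variable N : {sigma_finite_measure set (measurableTypeR R) -> \bar R}.
Hypothesis intN : forall a b, 0 < a -> 0 < b -> N.-integrable setT (EFin \o exp_weight a b).

Lemma integrable_expR t : 0 < t -> N.-integrable setT (fun x => (expR (- (t * x)))%:E).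
Proof.
move=> t0; apply: le_integrable (intN t0 t0) => //.
  apply/measurable_EFinP; apply: continuous_measurable_fun => x.
  by have := @continuous_expRM R t x; under eq_fun do rewrite mulrC.
move=> x _ /=; rewrite lee_fin ger0_norm ?expR_ge0// ger0_norm ?(ltW (exp_weight_gt0 _ _ _))//.
by rewrite le_exp_weight ?lexx.
Qed.

Let kernel (z : measurableTypeR R * measurableTypeR R) : R := expR (- (z.1 * z.2)).

Let measurable_kernel : measurable_fun setT kernel.
Proof.
apply: measurableT_comp => //; apply: measurable_funN.
by apply: measurable_funM; [exact: measurable_fst|exact: measurable_snd].
Qed.

(** For [t <= 0] the integral may diverge, and [U t] is then the default value 0; test functions
    vanish there. *)
Let U t := \int[N]_x expR (- (t * x)).

Let Ue t : \bar R := (\int[N]_x (kernel (t, x))%:E)%E.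

Let UeE t : 0 < t -> Ue t = (U t)%:E.
Proof.
by move=> t0; rewrite /U /Rintegral fineK// (integrable_fin_num _ (integrable_expR t0)).
Qed.

Lemma measurable_laplace_measure : measurable_fun setT U.
Proof.
have -> : U = fine \o Ue by [].
apply: measurableT_comp; first exact: fine_measurable.
apply: (measurable_fun_fubini_tonelli_F (m2 := N) (EFin \o kernel)).
  exact/measurable_EFinP.
by move=> z; rewrite lee_fin expR_ge0.
Qed.

Lemma laplace_measure_ge0 t : 0 <= U t.
Proof. by apply: Rintegral_ge0 => x _; rewrite expR_ge0. Qed.

Let W a b := \int[N]_x exp_weight a b x.

Lemma laplace_measure_le a b t : 0 < a -> a <= t <= b -> U t <= W a b.
Proof.
move=> a0 tab; have /andP[at_ tb] := tab.
have t0 : 0 < t by exact: lt_le_trans at_.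
apply: le_Rintegral => //; first exact: integrable_expR.
  by apply: intN => //; exact: lt_le_trans tb.
by move=> x _; exact: le_exp_weight.
Qed.

Lemma integral_laplace F : rtest F -> \int[N]_x laplace F x = \int[mu]_t (F t * U t).
Proof.
move=> tF; have cF := rtest_continuous tF; case: tF => _ [a [b [a0 ab sF]]].
have [K K0 HK] := supp_in_bounded cF sF.
pose f (z : measurableTypeR R * measurableTypeR R) : \bar R := (F z.1 * kernel z)%:E.
have mf : measurable_fun setT f.
  apply/measurable_EFinP; apply: measurable_funM => //.
  apply: (@measurableT_comp _ _ _ _ _ _ F) => //; exact: continuous_measurable_fun.
(* Off [a, b] the kernel need not be integrable, but the section is identically zero; hence the case
   distinction here and in [fN]. *)
have fE t : (\int[N]_x f (t, x))%E = (F t * U t)%:E.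
  have [/andP[at_ tb]|/sF F0] := boolP (a <= t <= b); last first.
    rewrite F0 mul0r; under eq_integral do rewrite /f /= F0 mul0r.
    by rewrite integral0.
  have t0 : 0 < t by exact: lt_le_trans at_.
  rewrite EFinM -UeE// /Ue -integralZl//; exact: integrable_expR.
have fN t : (\int[N]_x `|f (t, x)|)%E = (`|F t| * U t)%:E.
  have [/andP[at_ tb]|/sF F0] := boolP (a <= t <= b); last first.
    rewrite F0 normr0 mul0r; under eq_integral do rewrite /f /= F0 mul0r normr0.
    by rewrite integral0.
  have t0 : 0 < t by exact: lt_le_trans at_.
  rewrite EFinM -UeE// /Ue -integralZl//; last exact: integrable_expR.
  by apply: eq_integral => x _; rewrite /f /= normrM (ger0_norm (expR_ge0 _)).
have imf : (mu \x N)%E.-integrable setT f.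
  apply/(integrable12ltyP _ _ mf).
  under eq_integral do rewrite fN.
  have W0 : 0 <= W a b by apply: Rintegral_ge0 => x _; exact/ltW/exp_weight_gt0.
  apply: (@le_lt_trans _ _ (\int[mu]_(t in `[a, b]) (K * W a b)%:E)%E); last first.
    by rewrite integral_cst//= lebesgue_measure_itv/=; case: ifP => _; rewrite ?mule0// -EFinB -EFinM ltry.
  rewrite [leRHS]integral_mkcond; apply: ge0_le_integral => //.
  - by move=> t _; rewrite lee_fin mulr_ge0 ?laplace_measure_ge0.
  - apply/measurable_EFinP; apply: measurable_funM; last exact: measurable_laplace_measure.
    by apply: continuous_measurable_fun => t; apply: cvg_norm; exact: cF.
  - by apply/measurable_restrict => //; exact: measurable_cst.
  - move=> t _; rewrite patchE; case: (boolP (t \in _)) => [|/negP].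
      rewrite inE/= in_itv/= => tab; rewrite lee_fin ler_pM ?laplace_measure_ge0//.
      exact: laplace_measure_le.
    rewrite inE/= in_itv/= => /negP/sF ->; by rewrite normr0 mul0r.
rewrite /Rintegral; congr fine.
under [RHS]eq_integral do rewrite -fE.
rewrite (Fubini imf); apply: eq_integral => x _.
rewrite /laplace /Rintegral fineK//; apply: integrable_fin_num => //.
apply: (@supp_in_integrable _ _ a b) => //; last exact: supp_in_mull.
exact: continuous_laplace_integrand.
Qed.

End fubini.
End psd_representation.

(** * Complex test functions *)

Local Open Scope complex_scope.

Section complex_test_functions.
Variable R : realType.
Implicit Types (f g : R -> R) (F : R -> R[i]) (a b t x : R).
Notation mu := (@lebesgue_measure R).

Lemma compact_pos_bounds (K : set R) : compact K -> K `<=` `]0, +oo[%classic ->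
  exists a b, [/\ 0 < a, a <= b & K `<=` `[a, b]%classic].
Proof.
move=> cK K0; have [->|/set0P Kn0] := eqVneq K set0.
  by exists 1, 1; split => // x [].
have ci : {within K, continuous (idfun : R -> R)}.
  by apply: continuous_subspaceT => x; exact: cvg_id.
have [a /[!inE] Ka Ha] := compact_EVT_min Kn0 cK ci.
have [b /[!inE] Kb Hb] := compact_EVT_max Kn0 cK ci.
exists a, b; split.
- by have := K0 _ Ka; rewrite /= in_itv/= andbT.
- by apply: Ha; rewrite inE.
- by move=> x Kx; rewrite /= in_itv/= Ha ?Hb ?inE.
Qed.

Lemma csupp_supp_in F a b : csupp F `<=` `[a, b]%classic ->
  supp_in a b (fun x => complex.Re (F x)) /\ supp_in a b (fun x => complex.Im (F x)).
Proof.
move=> FK; suff H x : ~~ (a <= x <= b) -> F x = 0.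
  by split=> x /H ->.
move=> xab; apply/eqP; apply: contraNT xab => Fx.
by have := FK x; rewrite /= in_itv/=; apply; exact: subset_closure.
Qed.

Lemma test_function_rtest F : test_function F ->
  rtest (fun x => complex.Re (F x)) /\ rtest (fun x => complex.Im (F x)).
Proof.
move=> [[sR sI] cK K0]; have [a [b [a0 ab Kab]]] := compact_pos_bounds cK K0.
have [r i] := csupp_supp_in Kab.
by split; split=> //; exists a, b.
Qed.

Lemma csupp_real f a b : supp_in a b f -> csupp (fun x => (f x)%:C) `<=` `[a, b]%classic.
Proof.
move=> sf; rewrite [X in _ `<=` X](closure_id _).1; last exact: itv_closed.
apply: closure_subset => x /= fx; rewrite in_itv/=; apply: contraNT fx => /sf ->.
by [].
Qed.

Lemma rtest_test_function f : rtest f -> test_function (fun x => (f x)%:C).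
Proof.
move=> [sf [a [b [a0 ab s0]]]]; have K := csupp_real s0; split.
- by split; [exact: sf|exact: smooth0].
- apply: (subclosed_compact _ (@segment_compact R a b)) => //; exact: closed_closure.
- move=> x /K; rewrite /= !in_itv/= andbT => /andP[ax _].
  exact: lt_le_trans ax.
Qed.

Lemma le_Re_normc (z : R[i]) : `|complex.Re z| <= ComplexField.Normc.normc z.
Proof. by case: z => x y /=; rewrite -sqrtr_sqr ler_wsqrtr// lerDl sqr_ge0. Qed.

Lemma le_Im_normc (z : R[i]) : `|complex.Im z| <= ComplexField.Normc.normc z.
Proof. by case: z => x y /=; rewrite -sqrtr_sqr ler_wsqrtr// lerDr sqr_ge0. Qed.

Lemma test_norm_real_le f N e : (forall k x, (k <= N)%N -> `|derive1n k f x| <= e) ->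
  test_norm N (fun x => (f x)%:C) <= N.+1%:R * e.
Proof.
move=> H; have d0 k : derive1n k (fun _ : R => 0 : R) = fun=> 0.
  by apply: (@is_derive_derive1n _ (fun _ _ => 0)) => j x; exact: is_derive_cst.
rewrite mulr_natl -[N.+1 in leRHS]card_ord -sumr_const; apply: ler_sum => k _.
apply: ge_sup => [|_ [t _ <-]]; first by exists (ComplexField.Normc.normc (cderive k (fun x => (f x)%:C) 0)), 0.
by rewrite /cderive /= d0 expr0n addr0 sqrtr_sqr H// -ltnS.
Qed.

(** For [s] outside [0, t] one of [s] and [t - s] is negative, hence below the support of [f], so
    both integrals have the same integrand. *)
Lemma laplace_conv_real f : rtest f ->
  laplace_conv (fun s => ((f s)%:C)^*) (fun s => (f s)%:C) = fun t => (conv f f t)%:C.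
Proof.
move=> tf; have [_ [a [b [a0 _ sf]]]] := tf.
apply/funext => t; rewrite /laplace_conv /cintegral.
congr (_ +i* _); last first.
  transitivity (\int[mu]_(s in `[0, t]) (0 : R)); last by rewrite Rintegral_cst// mul0r.
  by apply: eq_Rintegral => s _ /=; rewrite mulr0 oppr0 mul0r addr0.
rewrite Rintegral_mkcond; apply: eq_Rintegral => s _; rewrite patchE.
case: (boolP (s \in _)) => [_|/negP] /=; first by rewrite oppr0 mul0r subr0.
rewrite inE/= in_itv/= => /negP st.
have [/andP[h1 h2]|/sf ->] := boolP (a <= s <= b); last by rewrite mul0r.
rewrite [f (t - s)]sf ?mulr0//; apply: contra st => /andP[h3 h4].
by apply/andP; split; lra.
Qed.

Lemma num_conjE (z : R[i]) : Num.conj z = conjc z.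
Proof. by []. Qed.

(** The map [p] stands for the real part, the imaginary part and the opposite of the latter. *)
Lemma distribution_psd (h : (R -> R[i]) -> R[i]) (p : R[i] -> R) :
  is_distribution h ->
  (forall z w, p (z + w) = p z + p w) -> (forall c z, p (c%:C * z) = c * p z) ->
  (forall z, `|p z| <= ComplexField.Normc.normc z) ->
  (forall f, rtest f -> 0 <= p (h (laplace_conv (fun s => ((f s)%:C)^*) (fun s => (f s)%:C)))) ->
  psd_functional (fun f => p (h (fun x => (f x)%:C))).
Proof.
move=> [hlin hcont] pD pZ ple ppos; split.
- move=> c f g tf tg; rewrite -pZ -pD.
  have := hlin c%:C _ _ (rtest_test_function tf) (rtest_test_function tg).
  rewrite num_conjE /= oppr0.
  move=> <-; congr (p (h _)); apply/funext => x.
  by rewrite rmorphD rmorphM.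
- move=> a b a0; have [|C [N HC]] := hcont `[a, b]%classic (@segment_compact R a b).
    by move=> x; rewrite /= !in_itv/= andbT => /andP[ax _]; exact: lt_le_trans ax.
  exists (`|C| * N.+1%:R), N; split; first by rewrite mulr_ge0.
  move=> f e sf s0 fe.
  (* An empty interval forces [f = 0], and the estimate then reduces to [h 0 = 0]. *)
  have [ab|ba] := leP a b; last first.
    have f0 : f = fun=> 0.
      by apply/funext => x; apply: s0; apply/negP => /andP[/le_trans H /H]; rewrite leNgt ba.
    have e0 : 0 <= e by exact: le_trans (fe 0%N 0 _).
    have p0 : p 0 = 0 by have := pD 0 0; rewrite addr0 => /eqP; rewrite -subr_eq subrr eq_sym => /eqP.
    have := hlin 1 _ _ (rtest_test_function (rtest0 R)) (rtest_test_function (rtest0 R)).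
    rewrite f0 (_ : (fun _ => _ + _) = fun=> (0 : R)%:C); last first.
      by apply/funext => x; rewrite mul1r -rmorphD addr0.
    rewrite num_conjE conjc1.
    rewrite mul1r => /eqP; rewrite -subr_eq subrr eq_sym => /eqP ->.
    by rewrite p0 normr0 !mulr_ge0.
  have tf : rtest f by split=> //; exists a, b.
  rewrite (le_trans (ple _))// (le_trans (HC _ (rtest_test_function tf) (csupp_real s0)))//.
  rewrite -mulrA; apply: (@le_trans _ _ (`|C| * test_norm N (fun x => (f x)%:C))); last first.
    by rewrite ler_wpM2l// test_norm_real_le.
  rewrite ler_wpM2r ?ler_norm//; apply: sumr_ge0 => k _.
  (* A set without a supremum has [sup] equal to 0, so each term of the norm is nonnegative in
     either case. *)
  set A := (X in sup X); have [[_ ubA]|noA] := pselect (has_sup A); last by rewrite sup_out.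
  apply: le_trans (ub_le_sup ubA (_ : A _)); last by exists 0.
  exact: sqrtr_ge0.
- by move=> f tf; rewrite -laplace_conv_real// ppos.
Qed.

End complex_test_functions.

Theorem theorem5p1 (R : realType) (h : (R -> R[i]) -> R[i])
  (hD : is_distribution h)
  (hpos : forall f : R -> R[i], test_function f ->
     0 <= h (laplace_conv (fun s => (f s)^*) f)) :
  exists M : {measure set (measurableTypeR R) -> \bar R},
    (forall t : R, 0 < t ->
       M.-integrable setT (fun l : R => (expR (- (t * l)))%:E)) /\
    distribution_is_function h
      (fun t : R => (Rintegral M setT (fun l : R => expR (- (t * l))))%:C).
Proof.
(* The order on [R[i]] makes [0 <= z] include that [z] is real, so the hypothesis yields two
   facts. *)
have hpos' f : rtest f ->
    complex.Im (h (laplace_conv (fun s => ((f s)%:C)^*) (fun s => (f s)%:C))) = 0 /\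
    0 <= complex.Re (h (laplace_conv (fun s => ((f s)%:C)^*) (fun s => (f s)%:C))).
  by move=> /rtest_test_function/hpos; rewrite lecE => /andP[/eqP -> ->].
have psdRe : psd_functional (fun f => complex.Re (h (fun x => (f x)%:C))).
  apply: distribution_psd => //.
  - by case=> x y [x' y'].
  - by move=> c [x y] /=; rewrite mul0r subr0.
  - exact: le_Re_normc.
  - by move=> f /hpos'[].
have psdIm : psd_functional (fun f => complex.Im (h (fun x => (f x)%:C))).
  apply: distribution_psd => //.
  - by case=> x y [x' y'].
  - by move=> c [x y] /=; rewrite mul0r addr0.
  - exact: le_Im_normc.
  - by move=> f /hpos'[->].
have psdImN : psd_functional (fun f => - complex.Im (h (fun x => (f x)%:C))).
  apply: (distribution_psd (p := fun z => - complex.Im z)) => //.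
  - by case=> x y [x' y'] /=; rewrite opprD.
  - by move=> c [x y] /=; rewrite mul0r addr0 mulrN.
  - by move=> z; rewrite normrN; exact: le_Im_normc.
  - by move=> f /hpos'[->]; rewrite oppr0.
have hreal f : rtest f -> h (fun x => (f x)%:C) = (complex.Re (h (fun x => (f x)%:C)))%:C.
  by move=> /(psd_opp_eq0 psdIm psdImN); case: (h _) => x y /= ->.
have [N [intN HN]] := psd_representation psdRe.
exists N; split; first by move=> t; exact: integrable_expR.
pose U t := \int[N]_x expR (- (t * x)).
have mU : measurable_fun setT U by exact: measurable_laplace_measure.
have oD : open `]0 : R, +oo[%classic by exact: interval_open.
split.
- split=> //; first exact: measurable_funTS.
  move=> K KD cK; have [a [b [a0 ab Kab]]] := compact_pos_bounds cK KD.
  have mK : measurable K by exact: compact_measurable.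
  apply: (@le_lt_trans _ _ (\int[lebesgue_measure]_(x in K) (\int[N]_x exp_weight a b x)%:E)%E).
    apply: ge0_le_integral => //.
    - by apply/measurable_EFinP; apply: measurableT_comp => //; exact: measurable_funTS.
    - move=> x /Kab; rewrite /= in_itv/= => xab.
      rewrite lee_fin ger0_norm; first exact: laplace_measure_le.
      exact: laplace_measure_ge0.
  rewrite integral_cst// lte_mul_pinfty//.
  + by rewrite lee_fin; apply: Rintegral_ge0 => x _; exact/ltW/exp_weight_gt0.
  + exact: compact_finite_measure.
- split=> //= K _ _.
  by under eq_integral do rewrite normr0; rewrite integral0.
move=> F tF; have [tR tI] := test_function_rtest tF.
(* [F] is [i] times its imaginary part plus its real part; antilinearity turns [i] into [- i],
   whence the sign. *)
have hF : h F = (complex.Re (h (fun x => (complex.Re (F x))%:C)) -i*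
                 complex.Re (h (fun x => (complex.Im (F x))%:C))).
  have [hlin _] := hD.
  have := hlin (0 +i* 1) _ _ (rtest_test_function tI) (rtest_test_function tR).
  rewrite (hreal _ tR) (hreal _ tI) num_conjE.
  rewrite (_ : (fun t => _ + _) = F); last first.
    by apply/funext => t; case: (F t) => x y; apply/eqP; rewrite eq_complex /=; apply/andP; split; apply/eqP; ring.
  by move=> ->; apply/eqP; rewrite eq_complex /=; apply/andP; split; apply/eqP; ring.
have int0 f : rtest f ->
    complex.Re (h (fun x => (f x)%:C)) = \int[lebesgue_measure]_(t in `]0, +oo[) (f t * U t).
  move=> tf; rewrite -(HN _ tf) (integral_laplace intN tf).
  have [_ [a [b [a0 _ sf]]]] := tf.
  rewrite -(@supp_in_integral _ _ a b `]0, +oo[)//; first exact: supp_in_mull.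
  by move=> x; rewrite /= !in_itv/= andbT => /andP[ax _]; exact: lt_le_trans ax.
rewrite hF /cintegral; congr (_ +i* _).
  rewrite (int0 _ tR); apply: eq_Rintegral => t _.
  by rewrite num_conjE -/(U t); case: (F t) => x y /=; ring.
(* The sign is moved inside the functional, to match the imaginary part of the conjugate of [F]
   under the integral. *)
have := psd_lin psdRe (-1) tI (rtest0 R).
rewrite (lin_functional0 (psd_lin psdRe)) addr0 mulN1r => <-.
rewrite int0; last by apply: rtest_lin => //; exact: rtest0.
apply: eq_Rintegral => t _.
by rewrite num_conjE -/(U t); case: (F t) => x y /=; ring.
Qed.
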